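(* If $(E,A)$ and $(F,B)$ are two (weakly) Morita equivalent $W^{*}$-correspondences, with implementing $W^*$-equivalence bimodule $X$, and $\sigma:B\to B(H)$ is a normal representation of $B$, then $\sigma\text{-Covrep}F$ and $\sigma^{X}\text{-Covrep}E$ are equivalent categories.
   Context: A $W^*$-correspondence $(E,A)$ is a selfdual right Hilbert $C^*$-module $E$ over a $W^*$-algebra $A$ together with a unital normal $*$-homomorphism $\varphi_E:A\to\mathscr{L}(E)$ into the adjointable maps on $E$ (the left action). $\overline\otimes$ denotes the $W^*$-module interior tensor product (selfdual completion of the balanced $C^*$-module interior tensor product). $(E,A)$ and $(F,B)$ are (weakly) Morita equivalent if there are an $A$-$B$ $W^*$-equivalence bimodule $X$ (an $A$-$B$ bimodule that is a selfdual Hilbert module on both sides, with compatible left $A$-valued and right $B$-valued inner products ${}_A\langle x,y\rangle z=x\langle y,z\rangle_B$, each of whose ranges spans a weak$^*$-dense subspace) and an isomorphism of $A$-$B$ $W^*$-correspondences $W:E\,\overline{\otimes}_{A}X\to X\,\overline{\otimes}_{B}F$. For a normal representation $\sigma:B\to B(H)$, $\sigma^X:A\to B(X\overline{\otimes}_\sigma H)$ is the induced normal representation $\sigma^X(a)(x\otimes h)=(a x)\otimes h$. For a $W^*$-correspondence $(F,B)$ and normal representation $\sigma:B\to B(H)$, $(F^{\sigma})^{*}=\{\eta^*\in B(F\otimes_\sigma H,H):\eta^*(\varphi_F(b)\otimes I_H)=\sigma(b)\eta^*\ \forall b\in B\}$, $\mathbb{D}((F^{\sigma})^{*})$ is its open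 unit ball, and $\mathrm{Aut}(\mathbb{D}((F^{\sigma})^{*}))$ is the group of biholomorphic self-maps of this ball. $\sigma\text{-Covrep}F$ is the category whose objects are the elements $\eta^*\in\mathbb{D}((F^{\sigma})^{*})$, with $\mathrm{Hom}(\eta_1^*,\eta_2^* )=\{g\in\mathrm{Aut}(\mathbb{D}((F^{\sigma})^{*})): g(\eta_1^* )=\eta_2^*\}$ and composition of maps as composition. $\sigma^X\text{-Covrep}E$ is the same construction applied to $(E,A)$ and $\sigma^X$: objects are the elements of $\mathbb{D}((E^{\sigma^X})^{*})$ and morphisms are the elements of $\mathrm{Aut}(\mathbb{D}((E^{\sigma^X})^{*}))$ carrying one object to the other. *)

(* Defs.v *)
From HB Require Import structures.
From mathcomp Require Import all_boot all_order all_algebra.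
From mathcomp Require Import complex.
From mathcomp Require Import all_classical all_reals all_analysis.

Set Implicit Arguments.
Unset Strict Implicit.
Unset Printing Implicit Defensive.

Import Order.TTheory GRing.Theory Num.Theory.
Import numFieldNormedType.Exports.

Local Open Scope classical_set_scope.
Local Open Scope ring_scope.
Local Open Scope complex_scope.

(* All vector spaces are complex, with scalars [R[i]] for [R : realType]; norms
   take their values in [R[i]].  As usual for Hilbert modules, inner products
   are linear in the second variable. *)

Definition lspan (K : numFieldType) (V : lmodType K) (S : set V) : set V :=
  [set v | exists (n : nat) (c : 'I_n -> K) (s : 'I_n -> V),
     (forall i, S (s i)) /\ v = \sum_(i < n) c i *: s i].

Definition opnorm (R : realType) (V W : normedModType R[i]) (f : V -> W)
    : R[i] :=
  (sup [set complex.Re `|f x| | x in [set x : V | `|x| <= 1]])%:C.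

(* The space B(V, W) of bounded operators, with the operator norm. *)
Section BoundedOperators.
Context (R : realType) (V W : normedModType R[i]).

Definition bop_pred : {pred (V -> W)} :=
  fun f => `[< linear f /\ continuous f >].

Record bop := Bop { bop_fun :> V -> W ; bop_funP : bop_fun \in bop_pred }.

Lemma bop_submod : submod_closed bop_pred.
Proof.
split.
  apply/asboolP; split; first by move=> k x y; rewrite scaler0 addr0.
  exact: cst_continuous.
move=> k f g /asboolP[lf cf] /asboolP[lg cg].
apply/asboolP; split=> [l x y|x].
  have E z : (k *: f + g) z = k *: f z + g z by [].
  rewrite !E lf lg !scalerDr !scalerA mulrC !addrA; congr (_ + _).
  by rewrite addrAC.
apply: (@continuousD _ _ _ (fun x => k *: f x) g); last exact: cg.
by apply: continuousZl_tmp; exact: cf.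
Qed.

HB.instance Definition _ := [isSub for bop_fun].
HB.instance Definition _ := [Choice of bop by <:].
HB.instance Definition _ :=
  GRing.isSubmodClosed.Build R[i] (V -> W) bop_pred bop_submod.
HB.instance Definition _ := [SubChoice_isSubLmodule of bop by <:].

Lemma bop_linear (f : bop) : linear f.
Proof. by case: f => f /= /asboolP[]. Qed.

Lemma bop_continuous (f : bop) : continuous f.
Proof. by case: f => f /= /asboolP[]. Qed.

Lemma bop0 (f : bop) : f 0 = 0.
Proof.
by have := bop_linear f (-1) 0 0; rewrite scaler0 addr0 scaleN1r addNr.
Qed.

Lemma bopZ (f : bop) k x : f (k *: x) = k *: f x.
Proof. by have := bop_linear f k x 0; rewrite !addr0 bop0 addr0. Qed.

Lemma bop_bounded (f : bop) :
  exists2 r : R, 0 <= r & forall x, `|f x| <= r%:C * `|x|.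
Proof.
pose l := GRing.isLinear.Build _ _ _ _ (bop_fun f) (bop_linear f).
pose F : {linear V -> W} := HB.pack (bop_fun f) l.
have /linear_boundedP/pinfty_ex_gt0[r r0 Hr] : bounded_near F (nbhs 0).
  by apply/linear_bounded_continuous; exact: bop_continuous.
have rE : r = (complex.Re r)%:C.
  by apply/esym/eqP; rewrite RRe_real// gtr0_real.
exists (complex.Re r); first by rewrite -lecR -rE ltW.
by move=> x; rewrite -rE; exact: Hr.
Qed.

Let normE (U : normedModType R[i]) (x : U) : `|x| = (complex.Re `|x|)%:C.
Proof. by apply/esym/eqP; rewrite RRe_real// normr_real. Qed.

Let opset (f : V -> W) :=
  [set complex.Re `|f x| | x in [set x : V | `|x| <= 1]].

Let opset_sup (f : bop) : has_sup (opset f).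
Proof.
split; first by exists (complex.Re `|f 0|), 0 => //=; rewrite normr0.
have [r r0 Hr] := bop_bounded f; exists r => _ [x /= x1 <-].
by rewrite -lecR -normE (le_trans (Hr x))// ler_piMr// lecR.
Qed.

Lemma opnorm_ge0 (f : bop) : 0 <= opnorm f.
Proof.
rewrite lecR; apply: (@le_trans _ _ (complex.Re `|f 0|)).
  by rewrite -lecR -normE; exact: normr_ge0.
apply: sup_upper_bound; first exact: opset_sup.
by exists 0 => //=; rewrite normr0.
Qed.

Lemma le_opnorm (f : bop) x : `|f x| <= opnorm f * `|x|.
Proof.
have [->|x0] := eqVneq x 0; first by rewrite bop0 !normr0 mulr0.
rewrite -ler_pdivrMr ?normr_gt0// mulrC -[X in X * _]ger0_norm ?invr_ge0//.
rewrite -normrZ -bopZ [X in X <= _]normE /opnorm lecR.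
apply: sup_upper_bound; first exact: opset_sup.
by exists (`|x|^-1 *: x) => //=; rewrite normfZV.
Qed.

Lemma opnorm_le (f : bop) (c : R[i]) :
  0 <= c -> (forall x, `|f x| <= c * `|x|) -> opnorm f <= c.
Proof.
move=> c0 Hc.
have -> : c = (complex.Re c)%:C by apply/esym/eqP; rewrite RRe_real// ger0_real.
rewrite /opnorm lecR; apply: ge_sup; first by case: (opset_sup f).
move=> _ [x /= x1 <-]; rewrite -lecR -normE RRe_real ?ger0_real//.
by rewrite (le_trans (Hc x))// ler_piMr.
Qed.

Lemma opnormD (f g : bop) : opnorm (bop_fun (f + g)) <= opnorm f + opnorm g.
Proof.
apply: opnorm_le => [|x]; first by rewrite addr_ge0// opnorm_ge0.
by rewrite (le_trans (ler_normD _ _))// mulrDl lerD// le_opnorm.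
Qed.

Let opnormZ_le k (f : bop) : opnorm (bop_fun (k *: f)) <= `|k| * opnorm f.
Proof.
apply: opnorm_le => [|x]; first by rewrite mulr_ge0// opnorm_ge0.
have -> : bop_fun (k *: f) x = k *: f x by [].
by rewrite normrZ -mulrA ler_wpM2l// le_opnorm.
Qed.

Lemma opnormZ k (f : bop) : opnorm (bop_fun (k *: f)) = `|k| * opnorm f.
Proof.
apply/eqP; rewrite eq_le opnormZ_le andTb.
have [->|k0] := eqVneq k 0; first by rewrite normr0 mul0r opnorm_ge0.
rewrite -ler_pdivlMl ?normr_gt0// -normfV.
by have := opnormZ_le k^-1 (k *: f); rewrite scalerA mulVf// scale1r.
Qed.

Lemma opnorm_eq0 (f : bop) : opnorm f = 0 -> f = 0.
Proof.
move=> f0; apply/val_inj/funext => x; apply/eqP; rewrite -normr_le0.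
by rewrite (le_trans (le_opnorm f x))// f0 mul0r.
Qed.

HB.instance Definition _ :=
  @Lmodule_isNormed.Build R[i] bop (fun f => opnorm f)
    opnormD opnormZ opnorm_eq0.

End BoundedOperators.

(* A W*-algebra in Sakai's sense: a unital C*-algebra which is, isometrically,
   the dual of a Banach space [predual] (uniquely determined by Sakai's
   theorem). *)
Record wstarAlg (R : realType) := WstarAlg {
  wcar :> completeNormedModType R[i] ;
  wmul : wcar -> wcar -> wcar ;
  wone : wcar ;
  wstar : wcar -> wcar ;
  wmulA : associative wmul ;
  wmul1l : left_id wone wmul ;
  wmul1r : right_id wone wmul ;
  wmul_linl : forall b, linear (wmul^~ b) ;
  wmul_linr : forall a, linear (wmul a) ;
  wnormM : forall a b, `|wmul a b| <= `|a| * `|b| ;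
  wstarK : involutive wstar ;
  wstar_antilin : forall (k : R[i]) a b,
    wstar (k *: a + b) = k^* *: wstar a + wstar b ;
  wstarM : forall a b, wstar (wmul a b) = wmul (wstar b) (wstar a) ;
  wnorm_star : forall a, `|wmul (wstar a) a| = `|a| ^+ 2 ;
  predual : completeNormedModType R[i] ;
  pairing : predual -> wcar -> R[i]^o ;
  pairing_linr : forall p, linear (pairing p) ;
  pairing_linl : forall a, linear (pairing^~ a) ;
  pairing_cont : forall a, continuous (pairing^~ a) ;
  pairing_norm : forall a, `|a| = opnorm (pairing^~ a) ;
  pairing_surj : forall f : predual -> R[i]^o,
    linear f -> continuous f -> exists a, f = pairing^~ a }.

Section WstarAlgebras.
Context (R : realType) (A : wstarAlg R).

Definition wpos (a : A) : Prop := exists b : A, a = wmul (wstar b) b.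

(* The weak*-continuous linear functionals are those given by the predual. *)
Definition normal_fun (f : A -> R[i]) : Prop :=
  exists p : predual A, f = pairing p.

Definition wdense (S : set A) : Prop :=
  forall (a : A) (ps : seq (predual A)) (e : R[i]), 0 < e ->
    exists2 b, S b & forall p, p \in ps -> `|pairing p b - pairing p a| < e.

End WstarAlgebras.

Record hmod (R : realType) (A : wstarAlg R) := Hmod {
  hmcar :> completeNormedModType R[i] ;
  ract : hmcar -> A -> hmcar ;
  inner : hmcar -> hmcar -> A ;
  ract_linl : forall a, linear (ract^~ a) ;
  ract_linr : forall x, linear (ract x) ;
  ractM : forall x a b, ract x (wmul a b) = ract (ract x a) b ;
  ract1 : forall x, ract x (wone A) = x ;
  inner_lin : forall x, linear (inner x) ;
  innerM : forall x y a, inner x (ract y a) = wmul (inner x y) a ;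
  inner_star : forall x y, wstar (inner x y) = inner y x ;
  inner_pos : forall x, wpos (inner x x) ;
  inner_norm : forall x, `|x| ^+ 2 = `|inner x x| }.

Section HilbertModules.
Context (R : realType) (A : wstarAlg R) (E : hmod A).

Definition selfdual : Prop :=
  forall f : E -> A, linear f -> continuous f ->
    (forall x a, f (ract x a) = wmul (f x) a) -> exists y, f = inner y.

(* The weak*-continuous functionals on a selfdual module: its predual is the
   norm-closed span, in the Banach dual, of the functionals [p (<w, _>)] with
   [w] in [E] and [p] in the predual of [A]. *)
Definition hm_normal_fun (f : E -> R[i]) : Prop :=
  forall e : R[i], 0 < e -> exists ws : seq (E * predual A), forall x,
    `|f x - \sum_(w <- ws) pairing w.2 (inner w.1 x)| <= e * `|x|.

Definition hm_wdense (S : set E) : Prop :=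
  forall (x : E) (n : nat) (f : 'I_n -> E -> R[i]) (e : R[i]),
    (forall i, hm_normal_fun (f i)) -> 0 < e ->
    exists2 y, S y & forall i, `|f i y - f i x| < e.

End HilbertModules.

(* A W*-correspondence from [A] to [B]; for [A = B] this is a
   W*-correspondence (E, A).  Each [lact a] is adjointable with adjoint
   [lact (wstar a)], so [lact] is a unital *-homomorphism into L(E).  Normality
   is weak*-continuity: the predual of L(E) is the norm-closed span of the
   functionals [T |-> p (<x, T y>)], and the predual of [A] is norm-closed, so
   these functionals suffice. *)
Record corr (R : realType) (A B : wstarAlg R) := Corr {
  cmod :> hmod B ;
  corr_selfdual : selfdual cmod ;
  lact : A -> cmod -> cmod ;
  lact_lin : forall x, linear (lact^~ x) ;
  lactM : forall a b x, lact (wmul a b) x = lact a (lact b x) ;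
  lact1 : forall x, lact (wone A) x = x ;
  lact_adj : forall a x y, inner (lact a x) y = inner x (lact (wstar a) y) ;
  lact_normal : forall x y (p : predual B),
    normal_fun (fun a => pairing p (inner x (lact a y))) }.

(* A W*-equivalence bimodule.  [linner] is the left inner product, linear in
   the first variable; [linner_norm] says that the two Hilbert module norms
   agree, which compatibility forces anyway. *)
Record equivBimod (R : realType) (A B : wstarAlg R) := EquivBimod {
  ebcorr :> corr A B ;
  linner : ebcorr -> ebcorr -> A ;
  linner_lin : forall y, linear (linner^~ y) ;
  linnerM : forall a x y, linner (lact a x) y = wmul a (linner x y) ;
  linner_star : forall x y, wstar (linner x y) = linner y x ;
  linner_pos : forall x, wpos (linner x x) ;
  linner_norm : forall x, `|x| ^+ 2 = `|linner x x| ;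
  left_selfdual : forall f : ebcorr -> A, linear f -> continuous f ->
    (forall a x, f (lact a x) = wmul a (f x)) -> exists y, f = linner^~ y ;
  linner_compat : forall x y z, lact (linner x y) z = ract x (inner y z) ;
  linner_full : wdense (lspan [set a | exists x y, a = linner x y]) ;
  inner_full : wdense (lspan [set b | exists x y : ebcorr, b = inner x y]) }.

(* A realization of the W*-module interior tensor product of [E] and [X]: a
   W*-correspondence containing the balanced algebraic tensor product, with its
   inner product, as a weak*-dense subspace.  This determines the selfdual
   completion up to a unique isomorphism fixing the simple tensors. *)
Record wtensor (R : realType) (A B D : wstarAlg R)
    (E : corr A B) (X : corr B D) := Wtensor {
  wtcorr :> corr A D ;
  wt : E -> X -> wtcorr ;
  wt_linl : forall x, linear (wt^~ x) ;
  wt_linr : forall e, linear (wt e) ;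
  wt_bal : forall e b x, wt (ract e b) x = wt e (lact b x) ;
  wt_inner : forall e x e' x',
    inner (wt e x) (wt e' x') = inner x (lact (inner e e') x') ;
  wt_ract : forall e x d, ract (wt e x) d = wt e (ract x d) ;
  wt_lact : forall a e x, lact a (wt e x) = wt (lact a e) x ;
  wt_dense : hm_wdense (lspan [set z | exists e x, z = wt e x]) }.

Definition corr_iso (R : realType) (A B : wstarAlg R) (Y Z : corr A B)
    (W : Y -> Z) : Prop :=
  [/\ linear W, bijective W,
      (forall y y', inner (W y) (W y') = inner y y'),
      (forall a y, W (lact a y) = lact a (W y)) &
      (forall y b, W (ract y b) = ract (W y) b)].

Definition morita_via (R : realType) (A B : wstarAlg R)
    (E : corr A A) (F : corr B B) (X : equivBimod A B) : Prop :=
  exists (EX : wtensor E X) (XF : wtensor X F) (W : EX -> XF), corr_iso W.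

Record hilb (R : realType) := Hilb {
  hcar :> completeNormedModType R[i] ;
  hip : hcar -> hcar -> R[i]^o ;
  hip_lin : forall h, linear (hip h) ;
  hip_conj : forall h k, (hip h k)^* = hip k h ;
  hip_norm : forall h, `|h| ^+ 2 = hip h h }.

(* Normal representations; normality is weak*-continuity, tested as for
   [corr] above. *)
Record nrep (R : realType) (B : wstarAlg R) (H : hilb R) := Nrep {
  rep :> B -> bop H H ;
  rep_lin : linear rep ;
  repM : forall a b h, rep (wmul a b) h = rep a (rep b h) ;
  rep_adj : forall b h k, hip (rep b h) k = hip h (rep (wstar b) k) ;
  rep_normal : forall h k, normal_fun (fun b => hip h (rep b k)) }.

(* A realization of the Hilbert space obtained from [E] and [H] by the
   interior tensor product along [s], together with the representation
   [indrep] of [A] on it given by [a |-> lact a (x) I_H], i.e. the induced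
   representation s^E. *)
Record htensor (R : realType) (A B : wstarAlg R) (E : corr A B)
    (H : hilb R) (s : nrep B H) := Htensor {
  hthilb :> hilb R ;
  ht : E -> H -> hthilb ;
  ht_linl : forall h, linear (ht^~ h) ;
  ht_linr : forall x, linear (ht x) ;
  ht_bal : forall x b h, ht (ract x b) h = ht x (s b h) ;
  ht_inner : forall x h y k,
    hip (ht x h) (ht y k) = hip h (s (inner x y) k) ;
  ht_dense : closure (lspan [set z | exists x h, z = ht x h]) = setT ;
  indrep : nrep A hthilb ;
  indrepE : forall a x h, indrep a (ht x h) = ht (lact a x) h }.

(* The space (F^s)^* of intertwiners, a normed subspace of B(F (x)_s H, H). *)
Section Intertwiners.
Context (R : realType) (B : wstarAlg R) (F : corr B B) (H : hilb R).
Context (s : nrep B H) (FH : htensor F s).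

Definition covec_pred : {pred bop FH H} :=
  fun eta => `[< forall b z, eta (indrep FH b z) = s b (eta z) >].

Record covec := Covec { covec_bop :> bop FH H ; _ : covec_bop \in covec_pred }.

Lemma covec_submod : submod_closed covec_pred.
Proof.
split; first by apply/asboolP => b z; rewrite [LHS]/= bop0.
move=> k f g /asboolP fP /asboolP gP; apply/asboolP => b z.
have E y : bop_fun (k *: f + g) y = k *: f y + g y by [].
by rewrite !E fP gP bop_linear.
Qed.

HB.instance Definition _ := [isSub for covec_bop].
HB.instance Definition _ := [Choice of covec by <:].
HB.instance Definition _ :=
  GRing.isSubmodClosed.Build R[i] (bop FH H) covec_pred covec_submod.
HB.instance Definition _ := [SubChoice_isSubLmodule of covec by <:].

Lemma covec_normD (f g : covec) :
  `|covec_bop (f + g)| <= `|covec_bop f| + `|covec_bop g|.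
Proof. exact: ler_normD. Qed.

Lemma covec_normZ k (f : covec) :
  `|covec_bop (k *: f)| = `|k| * `|covec_bop f|.
Proof. exact: normrZ. Qed.

Lemma covec_norm_eq0 (f : covec) : `|covec_bop f| = 0 -> f = 0.
Proof. by move=> /normr0_eq0 f0; exact: val_inj. Qed.

HB.instance Definition _ := @Lmodule_isNormed.Build R[i] covec
  (fun f => `|covec_bop f|) covec_normD covec_normZ covec_norm_eq0.

End Intertwiners.

Record category := Category {
  Ob : Type ;
  Hom : Ob -> Ob -> Type ;
  idm : forall a, Hom a a ;
  compm : forall a b c, Hom b c -> Hom a b -> Hom a c ;
  comp1m : forall a b (f : Hom a b), compm (idm b) f = f ;
  compm1 : forall a b (f : Hom a b), compm f (idm a) = f ;
  compA : forall a b c d (h : Hom c d) (g : Hom b c) (f : Hom a b),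
    compm h (compm g f) = compm (compm h g) f }.

Record functor (C D : category) := Functor {
  fob :> Ob C -> Ob D ;
  fmor : forall a b, Hom a b -> Hom (fob a) (fob b) ;
  fmor1 : forall a, fmor (idm a) = idm (fob a) ;
  fmorM : forall a b c (g : Hom b c) (f : Hom a b),
    fmor (compm g f) = compm (fmor g) (fmor f) }.

Definition functor_id (C : category) : functor C C :=
  @Functor C C id (fun a b f => f) (fun=> erefl) (fun _ _ _ _ _ => erefl).

Lemma functor_comp1 (C D E : category) (G : functor D E) (F : functor C D) a :
  fmor G (fmor F (idm a)) = idm (G (F a)).
Proof. by rewrite !fmor1. Qed.

Lemma functor_compM (C D E : category) (G : functor D E) (F : functor C D)
    a b c (g : Hom b c) (f : Hom a b) :
  fmor G (fmor F (compm g f)) = compm (fmor G (fmor F g)) (fmor G (fmor F f)).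
Proof. by rewrite !fmorM. Qed.

Definition functor_comp (C D E : category)
    (G : functor D E) (F : functor C D) : functor C E :=
  @Functor C E (fun a => G (F a)) (fun a b f => fmor G (fmor F f))
    (functor_comp1 G F) (functor_compM G F).

Definition nat_iso (C D : category) (F G : functor C D) : Prop :=
  exists (t : forall a, Hom (F a) (G a)) (u : forall a, Hom (G a) (F a)),
    [/\ (forall a b (f : Hom a b),
           compm (t b) (fmor F f) = compm (fmor G f) (t a)),
        (forall a, compm (u a) (t a) = idm (F a)) &
        (forall a, compm (t a) (u a) = idm (G a))].

Definition equivalent_cat (C D : category) : Prop :=
  exists (F : functor C D) (G : functor D C),
    nat_iso (functor_comp G F) (functor_id C) /\
    nat_iso (functor_comp F G) (functor_id D).

(* Biholomorphic self-maps of the open unit ball.  Holomorphic means complex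
   Frechet differentiable at every point of the ball; [differentiable] wants a
   function on the whole space, but as the ball is open the choice of extension
   is immaterial. *)
Section UnitBall.
Context (R : realType) (V : normedModType R[i]).

Definition uball := {x : V | `|x| < 1}.

Definition holo (g : uball -> uball) : Prop :=
  exists2 G : V -> V, (forall z, sval (g z) = G (sval z)) &
    forall z : uball, differentiable G (sval z).

Definition biholo (g : uball -> uball) : Prop :=
  holo g /\ exists h, [/\ cancel g h, cancel h g & holo h].

Definition ball_aut := {g : uball -> uball | biholo g}.

Lemma holo_id : holo id.
Proof. by exists id. Qed.

Lemma holo_comp g h : holo g -> holo h -> holo (g \o h).
Proof.
move=> [G gG dG] [K hK dK]; exists (G \o K) => z; first by rewrite /= gG hK.
by apply: differentiable_comp; [exact: dK|rewrite -hK; exact: dG].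
Qed.

Lemma biholo_id : biholo id.
Proof. by split; [exact: holo_id|exists id; split => //; exact: holo_id]. Qed.

Lemma biholo_comp g h : biholo g -> biholo h -> biholo (g \o h).
Proof.
move=> [hg [g' [gK g'K hg']]] [hh [h' [hK h'K hh']]].
split; first exact: holo_comp.
exists (h' \o g'); split; [exact: can_comp|exact: can_comp|exact: holo_comp].
Qed.

Definition aut_id : ball_aut := exist _ id biholo_id.

Definition aut_comp (g h : ball_aut) : ball_aut :=
  exist _ (sval g \o sval h) (biholo_comp (svalP g) (svalP h)).

Definition ball_hom (x y : uball) := {g : ball_aut | sval g x = y}.

Definition ball_hom_id x : ball_hom x x := exist _ aut_id erefl.

Lemma ball_hom_compP x y z (g : ball_hom y z) (f : ball_hom x y) :
  sval (aut_comp (sval g) (sval f)) x = z.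
Proof. by rewrite /= (svalP f) (svalP g). Qed.

Definition ball_hom_comp x y z (g : ball_hom y z) (f : ball_hom x y) :
  ball_hom x z := exist _ (aut_comp (sval g) (sval f)) (ball_hom_compP g f).

Lemma ball_hom_eq x y (f g : ball_hom x y) :
  sval (sval f) = sval (sval g) -> f = g.
Proof.
move=> fg; apply: eq_sig_hprop; first by move=> ? ? ?; exact: Prop_irrelevance.
by apply: eq_sig_hprop => // ? ? ?; exact: Prop_irrelevance.
Qed.

Lemma ball_hom_comp1m x y (f : ball_hom x y) :
  ball_hom_comp (ball_hom_id y) f = f.
Proof. exact: ball_hom_eq. Qed.

Lemma ball_hom_compm1 x y (f : ball_hom x y) :
  ball_hom_comp f (ball_hom_id x) = f.
Proof. exact: ball_hom_eq. Qed.

Lemma ball_hom_compA x y z w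
    (h : ball_hom z w) (g : ball_hom y z) (f : ball_hom x y) :
  ball_hom_comp h (ball_hom_comp g f) = ball_hom_comp (ball_hom_comp h g) f.
Proof. exact: ball_hom_eq. Qed.

Definition ball_cat : category :=
  Category ball_hom_comp1m ball_hom_compm1 ball_hom_compA.

End UnitBall.

Definition covrep (R : realType) (B : wstarAlg R) (F : corr B B) (H : hilb R)
    (s : nrep B H) (FH : htensor F s) : category :=
  ball_cat (covec FH).

(* Main.v *)
(** It suffices to find a linear isometry from [(F^s)^*] onto [(E^(s^X))^*]:
    conjugating by it carries one ball with its automorphism group onto the
    other.  The isometry sends [eta] to [zeta = (I_X (x) eta) u], where
    [u : E (x) X (x) H -> X (x) F (x) H] is the unitary induced by [W].

    Write [C_y] for [u] followed by the adjoint of [z |-> y (x) z], and [D_y]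
    for the adjoint of [h |-> y (x) h].  Both families satisfy
      [C_x^* C_y = <x, y>_A],   [C_x C_y^* = <x, y>_B],
    and the weak* density of the ranges of the two inner products makes the
    ranges of the [C_y], and those of the [C_y^*], total.  The correspondence
    is then given by either of [zeta C_y^* = D_y^* eta] and
    [eta C_y = D_y zeta].  Each equation determines one of [eta], [zeta] from
    the other, with a norm that does not increase: if [t P_i^* P_j =
    Q_i^* Q_j t] for all [i] and [j], then [P_i x |-> Q_i (t x)] extends to an
    operator of norm at most [|t|]. *)

From HB Require Import structures.
From mathcomp Require Import all_boot all_order all_algebra.
From mathcomp Require Import complex ring lra.
From mathcomp Require Import all_classical all_reals all_analysis.
Require Import Defs.

Set Implicit Arguments.
Unset Strict Implicit.
Unset Printing Implicit Defensive.

Import Order.TTheory GRing.Theory Num.Theory.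
Import numFieldNormedType.Exports.

Local Open Scope classical_set_scope.
Local Open Scope ring_scope.
Local Open Scope complex_scope.

(** * Norms and bounded operators *)

Section LinearPredicate.
Context (K : pzRingType) (U V : lmodType K) (f : U -> V).
Hypothesis lf : linear f.

Lemma lin_add x y : f (x + y) = f x + f y.
Proof. by have := lf 1 x y; rewrite !scale1r. Qed.

Lemma lin_zero : f 0 = 0.
Proof. by apply: (@addrI _ (f 0)); rewrite -lin_add !addr0. Qed.

Lemma lin_scale c x : f (c *: x) = c *: f x.
Proof. by have := lf c x 0; rewrite !addr0 lin_zero addr0. Qed.

Lemma lin_sub x y : f (x - y) = f x - f y.
Proof. by rewrite lin_add -scaleN1r lin_scale scaleN1r. Qed.

Lemma lin_sum I (s : seq I) (P : pred I) (F : I -> U) :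
  f (\sum_(i <- s | P i) F i) = \sum_(i <- s | P i) f (F i).
Proof. by apply: (big_morph f lin_add); exact: lin_zero. Qed.

End LinearPredicate.

Section RealNorm.
Context (R : realType) (V : normedModType R[i]).
Implicit Types (x y z : V) (k : R[i]).

(** Norms take values in [R[i]], whose order is only partial; the real copy gives access to
    total-order arguments and to [lra]. *)
Definition rnorm x : R := complex.Re `|x|.

Lemma normE x : `|x| = (rnorm x)%:C.
Proof. by apply/esym/eqP; rewrite RRe_real// normr_real. Qed.

Lemma rnorm_ge0 x : 0 <= rnorm x.
Proof. by rewrite -lecR -normE normr_ge0. Qed.

Lemma rnorm0 : rnorm 0 = 0.
Proof. by rewrite /rnorm normr0. Qed.

Lemma rnorm0_eq0 x : rnorm x = 0 -> x = 0.
Proof. by move=> x0; apply: normr0_eq0; rewrite normE x0. Qed.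

Lemma rnormD x y : rnorm (x + y) <= rnorm x + rnorm y.
Proof. by rewrite -lecR rmorphD /= -!normE ler_normD. Qed.

Lemma rnormZ k x : rnorm (k *: x) = complex.Re `|k| * rnorm x.
Proof.
by apply: complexI; rewrite rmorphM /= -!normE normrZ.
Qed.

Lemma rnormN x : rnorm (- x) = rnorm x.
Proof. by rewrite /rnorm normrN. Qed.

Lemma rnormB x y : rnorm (x - y) = rnorm (y - x).
Proof. by rewrite -rnormN opprB. Qed.

Lemma rnorm_tri z x y : rnorm (x - y) <= rnorm (x - z) + rnorm (z - y).
Proof. by rewrite (le_trans _ (rnormD _ _))// addrA subrK. Qed.

Lemma rnorm_small x : (forall e : R, 0 < e -> rnorm x <= e) -> x = 0.
Proof.
move=> xe; apply: rnorm0_eq0; apply/eqP; rewrite eq_le rnorm_ge0 andbT.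
by apply/ler_addgt0Pl => e e0; rewrite addr0 xe.
Qed.

Lemma rnorm_sum (I : Type) (s : seq I) (F : I -> V) :
  rnorm (\sum_(i <- s) F i) <= \sum_(i <- s) rnorm (F i).
Proof.
elim: s => [|i s IH]; first by rewrite !big_nil rnorm0.
by rewrite !big_cons (le_trans (rnormD _ _))// lerD2l.
Qed.

End RealNorm.

Lemma pow2_small (R : realType) (c : R) : 0 <= c ->
  forall e, 0 < e -> exists k : nat, c * 2^-1 ^+ k < e.
Proof.
move=> c0 e e0; have e1 : 0 < e / (c + 1) by rewrite divr_gt0// ltr_wpDl.
have : (2^-1 : R) ^+ k @[k --> \oo] --> 0.
  by apply: cvg_expr; rewrite gtr0_norm ?invf_lt1 ?ltr1n ?invr_gt0.
move/cvgr0Pnorm_lt => /(_ _ e1)[k _ /(_ k (leqnn k))] /=.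
rewrite ger0_norm ?exprn_ge0 ?invr_ge0// ltr_pdivlMr ?ltr_wpDl// => ke.
exists k; apply: le_lt_trans ke.
by rewrite mulrC ler_wpM2l ?exprn_ge0 ?invr_ge0// lerDl.
Qed.

Lemma pow_unbounded (R : realType) (q M : R) : 1 < q -> exists k : nat, M < q ^+ k.
Proof.
move=> q1; exists (Num.bound `|M / (q - 1)|).
set n := Num.bound _.
(* Bernoulli's inequality, by induction. *)
have qn : 1 + n%:R * (q - 1) <= q ^+ n.
  elim: n => [|n IH]; first by rewrite mul0r addr0 expr0.
  rewrite exprS -natr1; set m : R := n%:R in IH *.
  have m0 : 0 <= m by exact: ler0n.
  apply: (@le_trans _ _ (q * (1 + m * (q - 1)))); last first.
    by rewrite ler_wpM2l// ltW// (lt_trans ltr01).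
  have : 0 <= m * (q - 1) ^+ 2 by rewrite mulr_ge0// sqr_ge0.
  by lra.
apply: lt_le_trans qn; rewrite ltr_wpDl// -ltr_pdivrMr ?subr_gt0//.
by rewrite (le_lt_trans (ler_norm _))// archi_boundP.
Qed.

Section Completeness.
Context (R : realType) (V : completeNormedModType R[i]).

(** The a priori rate [d] survives in the limit, so later constructions work with explicit estimates
    instead of filters. *)
Lemma complete_rate (u : nat -> V) (d : nat -> R) :
  (forall e, 0 < e -> exists k, d k < e) ->
  (forall k l, (k <= l)%N -> rnorm (u k - u l) <= d k) ->
  exists x, forall k, rnorm (x - u k) <= d k.
Proof.
move=> d0 ud.
have reC (e : R[i]) : 0 < e -> e = (complex.Re e)%:C.
  by move=> e0; apply/esym/eqP; rewrite RRe_real// gtr0_real.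
have /cauchy_cvgP/cvg_ex[x ux] : cauchy (u @ \oo).
  apply: cauchy_exP => e e0.
  have [k ke] : exists k : nat, d k < complex.Re e by apply: d0; rewrite -ltcR -reC.
  exists (u k), k => // l kl; rewrite -ball_normE /ball_ /= normE (reC e)// ltcR.
  exact: le_lt_trans (ud k l kl) ke.
exists x => k; apply/ler_addgt0Pl => e e0.
have /cvgrPdist_lt/(_ e%:C) := ux; rewrite ltcR => /(_ e0)[N _ /(_ (maxn N k))].
move=> /(_ (leq_maxl _ _)); rewrite /= normE ltcR => xe.
apply: (le_trans (rnorm_tri (u (maxn N k)) _ _)); apply: lerD; first exact: ltW.
by rewrite rnormB; apply: ud; exact: leq_maxr.
Qed.

End Completeness.

Section BoundedLinear.
Context (R : realType) (V W : normedModType R[i]).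

Lemma bop_predP (f : V -> W) (M : R) : linear f ->
  (forall x, rnorm (f x) <= M * rnorm x) -> f \in @bop_pred R V W.
Proof.
move=> lf fM; apply/asboolP; split => //.
pose l := GRing.isLinear.Build _ _ _ _ f lf.
pose F : {linear V -> W} := HB.pack f l.
apply: (@bounded_linear_continuous _ _ _ F); apply/linear_boundedP.
exists (Num.max 0 M)%:C; split.
  by rewrite realE lecR le_max lexx.
move=> r; rewrite ltcE /= => /andP[/eqP ri Mr] x.
have -> : r = (complex.Re r)%:C by case: r ri {Mr} => a b /= ->.
rewrite !normE -rmorphM /= lecR (le_trans (fM x))// ler_wpM2r ?rnorm_ge0//.
by rewrite ltW// (le_lt_trans _ Mr)// le_max lexx orbT.
Qed.

Definition mk_bop (f : V -> W) M lf fM : bop V W := Bop (@bop_predP f M lf fM).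

Lemma bopD (f : bop V W) x y : f (x + y) = f x + f y.
Proof. by rewrite (lin_add (bop_linear f)). Qed.

Lemma bopB (f : bop V W) x y : f (x - y) = f x - f y.
Proof. by rewrite (lin_sub (bop_linear f)). Qed.

Lemma bop_eq (f g : bop V W) : f =1 g -> f = g.
Proof. by move=> fg; apply: val_inj; exact/funext. Qed.

Lemma bop_rnorm (f : bop V W) x : rnorm (f x) <= rnorm f * rnorm x.
Proof. by rewrite -lecR rmorphM /= -!normE; exact: le_opnorm. Qed.

Lemma bop_rnorm_le (f : bop V W) (M : R) : 0 <= M ->
  (forall x, rnorm (f x) <= M * rnorm x) -> rnorm f <= M.
Proof.
move=> M0 fM; rewrite -lecR -normE; apply: opnorm_le; first by rewrite lecR.
by move=> x; rewrite !normE -rmorphM /= lecR.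
Qed.

End BoundedLinear.

(** * Hilbert spaces *)

Lemma sqr_normc (R : realType) (z : R[i]) :
  complex.Re `|z| ^+ 2 = complex.Re z ^+ 2 + complex.Im z ^+ 2.
Proof. by rewrite normc_def /= sqr_sqrtr ?addr_ge0 ?sqr_ge0. Qed.

Section HilbertBasics.
Context (R : realType) (H : hilb R).
Implicit Types (x y z : H) (c : R[i]).

Lemma hipDr x y z : hip x (y + z) = hip x y + hip x z.
Proof. exact: lin_add (hip_lin x) y z. Qed.

Lemma hip0r x : hip x 0 = 0.
Proof. exact: lin_zero (hip_lin x). Qed.

Lemma hipZr x c y : hip x (c *: y) = c * hip x y.
Proof. exact: lin_scale (hip_lin x) c y. Qed.

Lemma hipBr x y z : hip x (y - z) = hip x y - hip x z.
Proof. exact: lin_sub (hip_lin x) y z. Qed.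

Lemma hipDl x y z : hip (x + y) z = hip x z + hip y z.
Proof. by rewrite -hip_conj hipDr rmorphD /= !hip_conj. Qed.

Lemma hip0l x : hip 0 x = 0.
Proof. by rewrite -hip_conj hip0r conjc0. Qed.

Lemma hipZl c x y : hip (c *: x) y = conjc c * hip x y.
Proof. by rewrite -hip_conj hipZr rmorphM /= hip_conj. Qed.

Lemma hipBl x y z : hip (x - y) z = hip x z - hip y z.
Proof. by rewrite -hip_conj hipBr rmorphB /= !hip_conj. Qed.

Lemma hip_sumr I (s : seq I) (F : I -> H) x :
  hip x (\sum_(i <- s) F i) = \sum_(i <- s) hip x (F i).
Proof. by rewrite (lin_sum (hip_lin x)). Qed.

Lemma hip_suml I (s : seq I) (F : I -> H) x :
  hip (\sum_(i <- s) F i) x = \sum_(i <- s) hip (F i) x.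
Proof.
by rewrite -hip_conj hip_sumr rmorph_sum; apply: eq_bigr => i _; exact: hip_conj.
Qed.

Lemma hip_eq0 x y : hip x y = 0 -> hip y x = 0.
Proof. by move=> xy; rewrite -hip_conj xy conjc0. Qed.

Lemma hipxx x : hip x x = (rnorm x ^+ 2)%:C.
Proof. by rewrite -hip_norm normE rmorphXn. Qed.

Lemma rnorm_sqr_hip x : rnorm x ^+ 2 = rnorm (hip x x : R[i]^o).
Proof. by rewrite hipxx /rnorm ger0_norm// lecR; exact: sqr_ge0. Qed.

Lemma hip_nondeg x y : (forall z, hip z x = hip z y) -> x = y.
Proof.
move=> xy; apply/subr0_eq/rnorm0_eq0/eqP; rewrite -sqrf_eq0.
by apply/eqP/complexI; rewrite -hipxx hipBr xy subrr.
Qed.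

Lemma rnorm_sqr_sum x y c : rnorm (x + c *: y) ^+ 2 =
  rnorm x ^+ 2 + complex.Re (c * hip x y) *+ 2
  + complex.Re `|c| ^+ 2 * rnorm y ^+ 2.
Proof.
apply: complexI; rewrite -hipxx hipDl !hipDr !hipZl !hipZr.
rewrite -[in conjc _ * _](hip_conj x y) !hipxx.
have -> : complex.Re `|c| ^+ 2 = complex.Re (conjc c * c).
  by rewrite sqr_normc; case: c => a b /=; ring.
case: (hip x y) => u v; case: c => a b /=; apply/eqP; rewrite eq_complex /=.
by apply/andP; split; apply/eqP; simpc => /=; ring.
Qed.

(** Put [c = -t <y, x>] with [t] real: the hypothesis becomes [-e <= -2tm + t^2 m |y|^2]. Taking
    [e = |x|^2] gives Cauchy-Schwarz; small [e] makes near-minimizers of a distance nearly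
    orthogonal. *)
Lemma near_min_orth x y (e : R) :
  (forall c, rnorm x ^+ 2 - e <= rnorm (x + c *: y) ^+ 2) ->
  rnorm (hip y x : R[i]^o) ^+ 2 <= e * rnorm y ^+ 2.
Proof.
set z := hip y x; set m := rnorm z ^+ 2 => xe.
have m0 : 0 <= m by exact: sqr_ge0.
have S0 : 0 <= rnorm y ^+ 2 by exact: sqr_ge0.
have Hm (t : R) : - e <= - (t * m) *+ 2 + t ^+ 2 * m * rnorm y ^+ 2.
  have := xe ((- t)%:C * z); rewrite rnorm_sqr_sum -(hip_conj y x) -/z.
  have -> : complex.Re ((- t)%:C * z * conjc z) = - (t * m).
    by rewrite /m sqr_normc; case: (z) => a b /=; ring.
  have -> : complex.Re `|(- t)%:C * z| ^+ 2 = t ^+ 2 * m.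
    by rewrite /m !sqr_normc; case: (z) => a b /=; ring.
  by lra.
have [y0|y0] := eqVneq (rnorm y ^+ 2) 0.
  rewrite y0 mulr0 leNgt; apply/negP => mgt0.
  (* Here the inequality is affine in [t], and this [t] makes its right side [-(e + 1)]. *)
  have := Hm ((e + 1) / (2 * m)); rewrite y0 mulr0 addr0.
  have -> : (e + 1) / (2 * m) * m = (e + 1) / 2 by field; lra.
  by lra.
have yn0 : rnorm y != 0 by rewrite -sqrf_eq0.
have {S0 y0} S0 : 0 < rnorm y ^+ 2 by rewrite lt0r y0.
(* The minimizer of the quadratic in [t]. *)
have := Hm (rnorm y ^+ 2)^-1; rewrite -ler_pdivrMr//.
have -> : (rnorm y ^+ 2)^-1 ^+ 2 * m * rnorm y ^+ 2 = m / rnorm y ^+ 2.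
  by field.
by rewrite (mulrC _ m); lra.
Qed.

Lemma hip_CS x y : rnorm (hip x y : R[i]^o) <= rnorm x * rnorm y.
Proof.
rewrite -ler_sqr ?nnegrE ?mulr_ge0 ?rnorm_ge0//.
rewrite exprMn mulrC near_min_orth// => c.
by rewrite subrr sqr_ge0.
Qed.

Lemma parallelogram x y :
  rnorm (x - y) ^+ 2 + rnorm (x + y) ^+ 2 = (rnorm x ^+ 2 + rnorm y ^+ 2) *+ 2.
Proof.
have -> : x + y = x + 1 *: y by rewrite scale1r.
have -> : x - y = x + (-1) *: y by rewrite scaleN1r.
by rewrite !rnorm_sqr_sum normrN normr1 mulN1r raddfN mul1r /=; ring.
Qed.

End HilbertBasics.

Section Projection.
Context (R : realType) (H : hilb R).

(** The subspace [S] may fail to be closed, so [p] is described as a limit of elements of [S]. *)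
Lemma hilb_proj (S : set H) : S 0 ->
  (forall c x y, S x -> S y -> S (c *: x + y)) -> forall u, exists p,
  (forall e : R, 0 < e -> exists2 v, S v & rnorm (p - v) <= e) /\
  (forall s, S s -> hip s (u - p) = 0).
Proof.
move=> S0 SD u.
pose D := [set rnorm (u - v) ^+ 2 | v in S].
have D_inf : has_inf D.
  by split; [exists (rnorm (u - 0) ^+ 2), 0|exists 0 => _ [v _ <-]; exact: sqr_ge0].
have infD v : S v -> inf D <= rnorm (u - v) ^+ 2.
  by move=> Sv; apply: inf_lbound; [case: D_inf|exists v].
have r0 k : 0 < 2^-1 ^+ k :> R by rewrite exprn_gt0// invr_gt0.
have /choice[v vP] (k : nat) : exists v,
    S v /\ rnorm (u - v) ^+ 2 <= inf D + (2^-1 ^+ k) ^+ 2.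
  have [|_ [v Sv <-] /ltW vk] := @inf_adherent _ D ((2^-1 ^+ k) ^+ 2) _ D_inf.
    by rewrite exprn_gt0.
  by exists v.
have [k l kl|p pv] := @complete_rate _ H v _ (@pow2_small R 2 (ler0n _ _)).
  (* The midpoint of [v k] and [v l] lies in [S], so the parallelogram law bounds [|v k - v l|] by
     [2 * 2^-k]. *)
  have mid : inf D <= rnorm (u - 2^-1 *: (v k + v l)) ^+ 2.
    apply: (infD); rewrite -[_ *: _]addr0; apply: (SD) => //.
    by rewrite -[v k]scale1r; apply: (SD); [case: (vP k)|case: (vP l)].
  have := parallelogram (u - v l) (u - v k).
  have -> : u - v l - (u - v k) = v k - v l by rewrite opprB addrC addrA subrK.
  have -> : u - v l + (u - v k) = 2 *: (u - 2^-1 *: (v k + v l)).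
    rewrite scalerBr scalerA mulfV ?pnatr_eq0// scale1r scaler_nat mulr2n.
    by rewrite opprD addrACA (addrC (- v l)).
  rewrite rnormZ normr_nat.
  have -> : complex.Re (2%:R : R[i]) = 2%:R by rewrite raddfMn.
  have [_ vk] := vP k; have [_ vl] := vP l.
  have lk : (2^-1 ^+ l) ^+ 2 <= (2^-1 ^+ k) ^+ 2 :> R.
    rewrite ler_sqr ?nnegrE ?(ltW (r0 _))//.
    by rewrite ler_wiXn2l ?invr_ge0 ?invf_le1 ?ler1n.
  rewrite -ler_sqr ?nnegrE ?rnorm_ge0 ?mulr_ge0 ?(ltW (r0 _))// !exprMn.
  by lra.
exists p; split.
  move=> e e0; have [k ke] := @pow2_small R 2 (ler0n _ _) e e0.
  by exists (v k); [case: (vP k)|rewrite (le_trans (pv k))// ltW].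
move=> s Ss; apply: (@rnorm_small _ R[i]^o) => e e0.
have [|k /ltW ke] := @pow2_small R (3 * rnorm s) _ e e0.
  by rewrite mulr_ge0 ?rnorm_ge0.
apply: (le_trans _ ke).
have -> : hip s (u - p) = hip s (u - v k) + hip s (v k - p).
  by rewrite -hipDr addrA subrK.
apply: (le_trans (rnormD (V := R[i]^o) _ _)).
have h1 : rnorm (hip s (u - v k) : R[i]^o) <= 2^-1 ^+ k * rnorm s.
  rewrite -ler_sqr ?nnegrE ?mulr_ge0 ?rnorm_ge0 ?(ltW (r0 k))//.
  rewrite exprMn; apply: near_min_orth => c.
  have -> : u - v k + c *: s = u - (- c *: s + v k).
    by rewrite opprD scaleNr opprK addrA addrAC.
  apply: (@le_trans _ _ (inf D)); first by case: (vP k) => _; lra.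
  by apply: (infD); apply: (SD) => //; case: (vP k).
have h2 : rnorm (hip s (v k - p) : R[i]^o) <= rnorm s * (2 * 2^-1 ^+ k).
  apply: (le_trans (hip_CS _ _)); rewrite ler_wpM2l ?rnorm_ge0//.
  by rewrite rnormB; exact: pv.
by lra.
Qed.

Lemma riesz (f : H -> R[i]) (M : R) :
  (forall c x y, f (c *: x + y) = c * f x + f y) ->
  (forall x, rnorm (f x : R[i]^o) <= M * rnorm x) ->
  exists v, forall x, f x = hip v x.
Proof.
move=> lf fM.
have f0 : f 0 = 0.
  by have := lf (-1) 0 0; rewrite scaler0 addr0 mulN1r addNr.
have fB x y : f (x - y) = f x - f y.
  by rewrite addrC -scaleN1r lf mulN1r addrC.
have [[x /eqP fx]|] := pselect (exists x, f x <> 0); last first.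
  by move=> /forallNP f00; exists 0 => x; rewrite hip0l; exact: contrapT.
have [||p [pS pO]] := @hilb_proj [set v | f v = 0] _ _ x; first exact: f0.
  by move=> c a b /= fa fb; rewrite lf fa fb mulr0 addr0.
have fp : f p = 0.
  apply: (@rnorm_small _ R[i]^o) => e e0.
  have M1 : 0 < Num.max M 1 by rewrite lt_max ltr01 orbT.
  have [|v /= fv pv] := pS (e / Num.max M 1); first by rewrite divr_gt0.
  have -> : f p = f (p - v) by rewrite fB fv subr0.
  apply: (le_trans (fM _)).
  apply: (@le_trans _ _ (Num.max M 1 * rnorm (p - v))).
    by rewrite ler_wpM2r ?rnorm_ge0// le_max lexx.
  by rewrite mulrC -ler_pdivlMr.
set z := x - p in pO.
have fz : f z != 0 by rewrite fB fp subr0.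
have zz : hip z z != 0.
  rewrite hipxx; apply/eqP => /complexI /eqP; rewrite sqrf_eq0 => /eqP z0.
  by move: fz; rewrite (rnorm0_eq0 z0) f0 eqxx.
(* The vector [y - (f y / f z) z] lies in the kernel of [f], hence is orthogonal to [z]. The
   conjugate appears because [hip] is antilinear in its first variable. *)
exists (conjc (f z / hip z z) *: z) => y; rewrite hipZl conjcK.
have yz : hip (- (f y / f z) *: z + y) z = 0.
  by apply: pO; rewrite /= lf mulNr divfK// addNr.
move/hip_eq0: yz; rewrite hipDr hipZr mulNr addrC => /subr0_eq ->.
by field; apply/andP; split.
Qed.

End Projection.

Section Adjoint.
Context (R : realType) (H K : hilb R) (T : bop H K).

Lemma adj_ex : exists S : bop K H,
  (forall k h, hip (S k) h = hip k (T h)) /\ rnorm S <= rnorm T.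
Proof.
have /choice[f fP] (k : K) : exists v, forall h, hip v h = hip k (T h).
  have [||v vP] := @riesz R H (fun h => hip k (T h)) (rnorm k * rnorm T).
  - by move=> c x y; rewrite bopD bopZ hipDr hipZr.
  - move=> x; rewrite -mulrA (le_trans (hip_CS _ _))// ler_wpM2l ?rnorm_ge0//.
    exact: bop_rnorm.
  by exists v => h; rewrite vP.
have lf : linear f.
  move=> c x y; apply: hip_nondeg => z; rewrite -[LHS]hip_conj -[RHS]hip_conj.
  by congr conjc; rewrite fP !hipDl !hipZl !fP.
have fle k : rnorm (f k) <= rnorm T * rnorm k.
  have [->|k0] := eqVneq (rnorm (f k)) 0; first by rewrite mulr_ge0 ?rnorm_ge0.
  have k1 : 0 < rnorm (f k) by rewrite lt0r k0 rnorm_ge0.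
  rewrite -(ler_pM2r k1) -expr2 rnorm_sqr_hip fP (le_trans (hip_CS _ _))//.
  by rewrite [leRHS]mulrAC mulrC ler_wpM2r ?rnorm_ge0// bop_rnorm.
exists (mk_bop lf fle); split => //.
exact: (bop_rnorm_le (f := mk_bop lf fle) (rnorm_ge0 T)).
Qed.

Definition adj : bop K H := sval (cid adj_ex).

Lemma adjE k h : hip (adj k) h = hip k (T h).
Proof. by rewrite /adj; case: cid => S []. Qed.

Lemma adjE' h k : hip h (adj k) = hip (T h) k.
Proof. by rewrite -hip_conj adjE hip_conj. Qed.

Lemma adj_norm : rnorm adj <= rnorm T.
Proof. by rewrite /adj; case: cid => S []. Qed.

End Adjoint.

(** * Extension and ampliation of operators *)

Section Total.
Context (R : realType) (H : hilb R) (J : Type).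
Implicit Types (g : J -> H) (s : seq (R[i] * J)).

(** A trivial orthogonal complement can be tested by inner products alone; [total_dense] turns it
    into density of the span. *)
Definition total_family g : Prop := forall u, (forall j, hip (g j) u = 0) -> u = 0.

(** One list of coefficients and indices serves several families at once, so combinations of [g] and
    [g'] can be compared before any map between them exists. *)
Definition lincomb (V : lmodType R[i]) (g : J -> V) s : V :=
  \sum_(p <- s) p.1 *: g p.2.

Lemma lincomb_cat (V : lmodType R[i]) (g : J -> V) s t :
  lincomb g (s ++ t) = lincomb g s + lincomb g t.
Proof. exact: big_cat. Qed.

Lemma lincomb_scale (V : lmodType R[i]) (g : J -> V) c s :
  lincomb g [seq (c * p.1, p.2) | p <- s] = c *: lincomb g s.
Proof.
rewrite /lincomb big_map scaler_sumr; apply: eq_bigr => p _ /=.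
by rewrite scalerA.
Qed.

Lemma lincomb1 (V : lmodType R[i]) (g : J -> V) j : lincomb g [:: (1, j)] = g j.
Proof. by rewrite /lincomb big_seq1 scale1r. Qed.

Lemma total_dense g : total_family g -> forall u (e : R), 0 < e ->
  exists s, rnorm (u - lincomb g s) <= e.
Proof.
move=> gT u e e0.
have [||p [pS pO]] := @hilb_proj R H (range (lincomb g)) _ _ u.
- by exists [::] => //; rewrite /lincomb big_nil.
- move=> c _ _ [s _ <-] [t _ <-].
  by exists ([seq (c * p.1, p.2) | p <- s] ++ t) => //;
    rewrite lincomb_cat lincomb_scale.
have -> : u = p.
  apply/subr0_eq/gT => j; apply: pO.
  by exists [:: (1, j)] => //; exact: lincomb1.
by have [_ [s _ <-] ?] := pS _ e0; exists s.
Qed.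

Lemma total_bop_eq (K : hilb R) g (S T : bop H K) :
  total_family g -> (forall j, S (g j) = T (g j)) -> S =1 T.
Proof.
move=> gT ST u; apply: hip_nondeg => v; rewrite -!adjE; congr hip.
by apply/subr0_eq/gT => j; rewrite hipBr !adjE' ST subrr.
Qed.

Section Extension.
Context (K : hilb R) (g : J -> H) (g' : J -> K) (M : R).
Hypothesis M0 : 0 <= M.
Hypothesis gT : total_family g.
Hypothesis gM : forall s, rnorm (lincomb g' s) <= M * rnorm (lincomb g s).

Let gMB s t :
  rnorm (lincomb g' s - lincomb g' t) <= M * rnorm (lincomb g s - lincomb g t).
Proof.
have := gM (s ++ [seq (-1 * p.1, p.2) | p <- t]).
by rewrite !lincomb_cat !lincomb_scale !scaleN1r.
Qed.

(* The value of the extension at [u] is characterized by all the estimates it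
   has to satisfy, which makes uniqueness and linearity easy. *)
Let is_ext u v := forall s, rnorm (v - lincomb g' s) <= M * rnorm (u - lincomb g s).

Let ext_ex u : exists v, is_ext u v.
Proof.
have /choice[s sP] (k : nat) : exists s, rnorm (u - lincomb g s) <= 2^-1 ^+ k.
  by apply: total_dense => //; rewrite exprn_gt0// invr_gt0.
have ss k l : (k <= l)%N ->
    rnorm (lincomb g (s k) - lincomb g (s l)) <= 2 * 2^-1 ^+ k.
  move=> kl; apply: (le_trans (rnorm_tri u _ _)).
  have sl : rnorm (u - lincomb g (s l)) <= 2^-1 ^+ k.
    by rewrite (le_trans (sP l))// ler_wiXn2l ?invr_ge0 ?invf_le1 ?ler1n.
  by rewrite rnormB; have := sP k; lra.
have M2 : 0 <= M * 2 by rewrite mulr_ge0.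
have [k l kl|v vP] :=
  @complete_rate _ K (fun k => lincomb g' (s k)) _ (pow2_small M2).
  by rewrite (le_trans (gMB _ _))// -mulrA ler_wpM2l// ss.
exists v => t; apply/ler_addgt0Pl => e e0.
have [|k /ltW ke] := @pow2_small R (M * 3) _ e e0; first by rewrite mulr_ge0.
apply: (le_trans (rnorm_tri (lincomb g' (s k)) _ _)).
have h1 := vP k; have h2 := gMB (s k) t.
have h3 : M * rnorm (lincomb g (s k) - lincomb g t) <=
    M * (2^-1 ^+ k + rnorm (u - lincomb g t)).
  rewrite ler_wpM2l// (le_trans (rnorm_tri u _ _))// lerD2r.
  by rewrite rnormB; exact: sP.
by lra.
Qed.

Let ext_fun u := sval (cid (ext_ex u)).

Let ext_funP u : is_ext u (ext_fun u).
Proof. by rewrite /ext_fun; case: cid. Qed.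

Let ext_linear : linear ext_fun.
Proof.
move=> c x y; apply/subr0_eq/rnorm_small => e e0.
pose m := complex.Re `|c| + 1.
have m0 : 0 <= complex.Re `|c| by exact: (@rnorm_ge0 _ R[i]^o).
(* [M + 1] and [m] keep the divisor positive. The extension at [c *: x + y] and the combination of
   its values at [x] and [y] will each be within [e / 2] of [w]. *)
have d0 : 0 < e / (2 * (M + 1) * m).
  by rewrite divr_gt0// !mulr_gt0// /m ltr_wpDl.
have [s xs] := total_dense gT x d0; have [t yt] := total_dense gT y d0.
set w := c *: lincomb g' s + lincomb g' t.
apply: (le_trans (rnorm_tri w _ _)).
have h1 := ext_funP (c *: x + y) ([seq (c * p.1, p.2) | p <- s] ++ t).
rewrite !lincomb_cat !lincomb_scale -/w in h1.
have E (U : lmodType R[i]) (a b a' b' : U) :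
    c *: a + b - (c *: a' + b') = c *: (a - a') + (b - b').
  by rewrite scalerBr opprD addrACA.
have tri (U : normedModType R[i]) (a b a' b' : U) :
    rnorm (c *: a + b - (c *: a' + b')) <=
    complex.Re `|c| * rnorm (a - a') + rnorm (b - b').
  by rewrite E (le_trans (rnormD _ _))// rnormZ.
have h2 : rnorm (w - (c *: ext_fun x + ext_fun y)) <=
    M * (complex.Re `|c| * rnorm (x - lincomb g s) + rnorm (y - lincomb g t)).
  rewrite rnormB (le_trans (tri _ _ _ _ _))// mulrDr mulrCA lerD//.
    by rewrite ler_wpM2l//; exact: ext_funP.
  exact: ext_funP.
have h3 : complex.Re `|c| * rnorm (x - lincomb g s) + rnorm (y - lincomb g t)
    <= e / (2 * (M + 1)).
  have -> : e / (2 * (M + 1)) =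
      complex.Re `|c| * (e / (2 * (M + 1) * m)) + e / (2 * (M + 1) * m).
    by rewrite /m; field; apply/andP; split; apply: lt0r_neq0; rewrite ltr_wpDl.
  by rewrite lerD// ler_wpM2l.
have h4 : M * (complex.Re `|c| * rnorm (x - lincomb g s)
    + rnorm (y - lincomb g t)) <= e / 2.
  apply: (@le_trans _ _ (M * (e / (2 * (M + 1))))); first by rewrite ler_wpM2l.
  have -> : M * (e / (2 * (M + 1))) = (e / 2) * (M / (M + 1)).
    by field; apply: lt0r_neq0; rewrite ltr_wpDl.
  rewrite ler_piMr ?divr_ge0 ?(ltW e0)// ler_pdivrMr ?ltr_wpDl//.
  by rewrite mul1r lerDl.
have h5 := tri _ x y (lincomb g s) (lincomb g t).
have h6 := ler_wpM2l M0 h5.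
by lra.
Qed.

Let ext_le u : rnorm (ext_fun u) <= M * rnorm u.
Proof.
by have := ext_funP u [::]; rewrite /lincomb !big_nil !subr0.
Qed.

Lemma bop_extension : exists T : bop H K,
  (forall j, T (g j) = g' j) /\ rnorm T <= M.
Proof.
exists (mk_bop ext_linear ext_le); split; last exact: bop_rnorm_le.
move=> j; apply/subr0_eq/rnorm0_eq0/eqP; rewrite eq_le rnorm_ge0 andbT /=.
by have := ext_funP (g j) [:: (1, j)]; rewrite !lincomb1 subrr rnorm0 mulr0.
Qed.

End Extension.
End Total.

(** A spectral radius argument on numbers: iterating [rN] gives [r_0^(2^n) N <= N^(2^n) r_n]. With
    the growth bound, the powers [(r_0 / (N M))^(2^n)] stay below [C / N], so the ratio cannot
    exceed 1. *)
Lemma spectral_bound (R : realType) (r : nat -> R) (N M C : R) :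
  0 <= N -> 0 <= M -> (forall n, 0 <= r n) ->
  (forall n, r n ^+ 2 <= N * r n.+1) ->
  (forall n, r n <= C * M ^+ (2 ^ n)) -> r 0%N <= N * M.
Proof.
move=> N0 M0 r0 rN rC.
have [N_eq0|N_neq0] := eqVneq N 0.
  have := rN 0%N; rewrite N_eq0 !mul0r => h.
  suff : r 0%N ^+ 2 == 0 by rewrite sqrf_eq0 => /eqP ->.
  by rewrite eq_le h sqr_ge0.
have {N_neq0} Np : 0 < N by rewrite lt0r N_neq0.
have claim n : r 0%N ^+ (2 ^ n) * N <= N ^+ (2 ^ n) * r n.
  elim: n => [|n IH]; first by rewrite expn0 !expr1 mulrC.
  rewrite -(ler_pM2r Np) expnS mulnC !exprM.
  apply: (@le_trans _ _ ((r 0%N ^+ (2 ^ n) * N) ^+ 2)).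
    by rewrite exprMn -mulrA -expr2.
  apply: (@le_trans _ _ ((N ^+ (2 ^ n) * r n) ^+ 2)).
    by rewrite ler_sqr ?nnegrE ?mulr_ge0 ?exprn_ge0.
  rewrite exprMn -[leRHS]mulrA ler_wpM2l ?exprn_ge0 ?(ltW Np)//.
  by rewrite [leRHS]mulrC; exact: rN.
have bnd n : r 0%N ^+ (2 ^ n) * N <= C * (N * M) ^+ (2 ^ n).
  by rewrite (le_trans (claim n))// exprMn mulrCA ler_wpM2l ?exprn_ge0.
rewrite leNgt; apply/negP => NMr.
have rp : 0 < r 0%N by apply: le_lt_trans NMr; rewrite mulr_ge0.
have [NM_eq0|NM_neq0] := eqVneq (N * M) 0.
  have := bnd 0%N; rewrite NM_eq0 expn0 !expr1 mulr0 leNgt => /negP; apply.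
  by rewrite mulr_gt0.
have NMp : 0 < N * M by rewrite lt0r NM_neq0 mulr_ge0.
have q1 : 1 < r 0%N / (N * M) by rewrite ltr_pdivlMr// mul1r.
have [k] := pow_unbounded (C / N) q1.
apply/negP; rewrite -leNgt.
apply: (@le_trans _ _ ((r 0%N / (N * M)) ^+ (2 ^ k))).
  by rewrite ler_weXn2l ?(ltW q1)// ltnW// ltn_expl.
by rewrite expr_div_n ler_pdivrMr ?exprn_gt0// mulrAC ler_pdivlMr.
Qed.

Lemma hip_lincomb_eq (R : realType) (H K : hilb R) (J J' : Type)
    (a : J -> H) (b : J' -> H) (a' : J -> K) (b' : J' -> K) s t :
  (forall j j', hip (a j) (b j') = hip (a' j) (b' j')) ->
  hip (lincomb a s) (lincomb b t) = hip (lincomb a' s) (lincomb b' t).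
Proof.
move=> ab; rewrite /lincomb !hip_suml; apply: eq_bigr => p _.
rewrite !hip_sumr; apply: eq_bigr => q _.
by rewrite !hipZl !hipZr ab.
Qed.

Section Transfer.
Context (R : realType) (K1 K2 L1 L2 : hilb R) (I : Type).
Context (P : I -> bop K1 L1) (Q : I -> bop K2 L2) (t : bop K1 K2).
Hypothesis tPQ : forall i j x, t (adj (P i) (P j x)) = adj (Q i) (Q j (t x)).

Let h x := adj t (t x).

(** [tPQ] lets [t] pass through the products of adjoints, which gathers both copies of [t] on one
    side as [h = t^* t]. *)
Let PhE i j x y : hip (Q i (t x)) (Q j (t y)) = hip (P i x) (P j (h y)).
Proof.
by rewrite -adjE -tPQ -adjE' adjE.
Qed.

(** The formal operator [P_i x |-> P_i (h x)] is symmetric, before it is known to be well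
    defined. *)
Let PhC i j x y : hip (P i (h x)) (P j y) = hip (P i x) (P j (h y)).
Proof. by rewrite -hip_conj -PhE hip_conj PhE. Qed.

Let Ph_iter i j x y m n : hip (P i (iter m h x)) (P j (iter n h y)) =
  hip (P i x) (P j (iter (m + n) h y)).
Proof.
by elim: m n => //= m IH n; rewrite PhC -iterS IH addnS.
Qed.

(** The [m]-th power of that formal operator, applied to the combination [s] of vectors [P_i x]. *)
Let u s m := lincomb (fun p : I * K1 => P p.1 (iter m h p.2)) s.

Let iter_h_le m x : rnorm (iter m h x) <= (rnorm t ^+ 2) ^+ m * rnorm x.
Proof.
elim: m => [|m IH]; first by rewrite mul1r.
rewrite iterS (le_trans (bop_rnorm _ _))//.
apply: (@le_trans _ _ (rnorm t * (rnorm t * rnorm (iter m h x)))).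
  by rewrite ler_pM ?rnorm_ge0 ?adj_norm ?bop_rnorm.
by rewrite mulrA -expr2 (exprS (_ ^+ 2)) -[leRHS]mulrA ler_wpM2l ?sqr_ge0.
Qed.

(* Powers of the positive operator [h = t^* t] stand in for the square root of
   [|t|^2 - h], which would be needed in the usual proof that a module map
   ampliates to an operator of the same norm. *)
Let transfer_le s :
  rnorm (lincomb (fun p : I * K1 => Q p.1 (t p.2)) s) <=
  rnorm t * rnorm (lincomb (fun p : I * K1 => P p.1 p.2) s).
Proof.
rewrite -[X in rnorm t * rnorm X]/(u s 0); set v := lincomb _ s.
have vu : rnorm v ^+ 2 <= rnorm (u s 0) * rnorm (u s 1).
  rewrite (le_trans _ (hip_CS _ _))//.
  have <- : hip v v = hip (u s 0) (u s 1).
    by apply: hip_lincomb_eq => p q; exact: PhE.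
  by rewrite rnorm_sqr_hip.
have uu n : rnorm (u s (2 ^ n)) ^+ 2 <= rnorm (u s 0) * rnorm (u s (2 ^ n.+1)).
  rewrite (le_trans _ (hip_CS _ _))//.
  have <- : hip (u s (2 ^ n)) (u s (2 ^ n)) = hip (u s 0) (u s (2 ^ n.+1)).
    by apply: hip_lincomb_eq => p q; rewrite Ph_iter addnn -mul2n -expnS.
  by rewrite rnorm_sqr_hip.
(* The growth constant is a crude termwise bound; what matters is that it does not depend on [n]. *)
have := @spectral_bound R (fun n => rnorm (u s (2 ^ n))) (rnorm (u s 0))
  (rnorm t ^+ 2)
  (\sum_(p <- s) complex.Re `|p.1| * (rnorm (P p.2.1) * rnorm p.2.2)).
move=> /(_ (rnorm_ge0 _) (sqr_ge0 _) (fun=> rnorm_ge0 _) uu) /=.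
rewrite expn0 => H; have {H} u1 : rnorm (u s 1) <= rnorm (u s 0) * rnorm t ^+ 2.
  apply: H => n; rewrite (le_trans (rnorm_sum _ _))// mulr_suml.
  apply: ler_sum => p _; rewrite rnormZ -!mulrA ler_wpM2l//.
    exact: (@rnorm_ge0 _ R[i]^o).
  rewrite (le_trans (bop_rnorm _ _))// ler_wpM2l ?rnorm_ge0//.
  by rewrite mulrC; exact: iter_h_le.
rewrite -ler_sqr ?nnegrE ?mulr_ge0 ?rnorm_ge0// (le_trans vu)//.
by rewrite (le_trans (ler_wpM2l (rnorm_ge0 _) u1))// mulrA -expr2 exprMn mulrC.
Qed.

Lemma bop_transfer : total_family (fun p : I * K1 => P p.1 p.2) ->
  exists T : bop L1 L2, (forall i x, T (P i x) = Q i (t x)) /\ rnorm T <= rnorm t.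
Proof.
move=> PT; have [T [TP Tt]] := bop_extension (rnorm_ge0 t) PT transfer_le.
by exists T; split => // i x; exact: (TP (i, x)).
Qed.

End Transfer.

(** * Boundedness of the module operations *)

Section UniformBoundedness.
Context (R : realType) (V : completeNormedModType R[i]) (W : normedModType R[i]).

(** Choose [w] of norm [r] at which [T] nearly attains its norm. As [T (x + w) - T (x - w) = 2 T w],
    one of [x + w] and [x - w] serves. The factor [2 / 3] leaves room because the norm need not be
    attained. *)
Lemma bop_almost_norming (T : bop V W) (x : V) (r : R) : 0 < r -> 0 < rnorm T ->
  exists y, rnorm (y - x) <= r /\ 2 / 3 * r * rnorm T <= rnorm (T y).
Proof.
move=> r0 T0.
have [z zT] : exists z, 2 / 3 * rnorm T * rnorm z < rnorm (T z).
  apply: contrapT => /forallNP zT.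
  suff : rnorm T <= 2 / 3 * rnorm T by lra.
  apply: bop_rnorm_le => [|z]; first by lra.
  by rewrite leNgt; apply/negP; exact: zT.
have z0 : 0 < rnorm z.
  rewrite lt0r rnorm_ge0 andbT; apply/eqP => /rnorm0_eq0 z0.
  by move: zT; rewrite z0 bop0 !rnorm0 mulr0 ltxx.
pose w := (r / rnorm z)%:C *: z.
have nC (c : R) : 0 <= c -> complex.Re `|c%:C| = c.
  by move=> c0; rewrite ger0_norm ?lecR.
have rz0 : 0 <= r / rnorm z by rewrite divr_ge0 ?ltW.
have wr : rnorm w = r by rewrite rnormZ nC// divfK// gt_eqF.
have wT : 2 / 3 * r * rnorm T <= rnorm (T w).
  rewrite bopZ rnormZ nC// -ler_pdivrMl; last by rewrite divr_gt0.
  rewrite [leLHS](_ : _ = 2 / 3 * rnorm T * rnorm z) ?ltW//.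
  by field; apply/andP; split; rewrite gt_eqF.
have [h|h] := lerP (2 / 3 * r * rnorm T) (rnorm (T (x + w))).
  by exists (x + w); rewrite addrC addKr wr.
exists (x - w); split; first by rewrite addrC addKr rnormN wr.
have := rnormD (T (x + w)) (- T (x - w)).
rewrite -bopB opprB addrC addrA subrK -mulr2n -scaler_nat bopZ rnormZ rnormN.
have -> : complex.Re `|2%:R : R[i]| = 2 by rewrite normr_nat raddfMn.
by lra.
Qed.

(** A gliding hump argument: the points [u k] move by ever smaller steps, each making the value of
    [T (i k)] large, and their limit contradicts pointwise boundedness. *)
Lemma uniform_boundedness (I : Type) (T : I -> bop V W) :
  (forall x, exists M, forall i, rnorm (T i x) <= M) ->
  exists2 M, 0 <= M & forall i, rnorm (T i) <= M.
Proof.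
move=> Tx; apply: contrapT => TM.
have big (M : R) : 0 <= M -> exists i, M < rnorm (T i).
  move=> M0; apply: contrapT => /forallNP Mi; apply: TM; exists M => // i.
  by rewrite leNgt; apply/negP; exact: Mi.
(* With this ratio, the steps that follow the one of size [q ^+ k.+1] add up to at most a third of
   it, against the [2 / 3] gained there. So [|T (i k) x|] is at least [q ^+ k.+1 * |T (i k)| / 3],
   which exceeds [k]. *)
pose q : R := 4^-1.
have q0 : 0 < q by rewrite invr_gt0.
have qn n : 0 < q ^+ n by rewrite exprn_gt0.
have /choice[i iP] (k : nat) : exists i, 3 * k%:R / q ^+ k.+1 < rnorm (T i).
  by apply: big; rewrite divr_ge0 ?mulr_ge0 ?(ltW (qn _)).
have /choice[f fP] (p : nat * V) : exists y, rnorm (y - p.2) <= q ^+ p.1.+1 /\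
    2 / 3 * q ^+ p.1.+1 * rnorm (T (i p.1)) <= rnorm (T (i p.1) y).
  apply: bop_almost_norming => //; apply: le_lt_trans (iP p.1).
  by rewrite divr_ge0 ?mulr_ge0 ?(ltW (qn _)).
pose u := fix u k := if k is k'.+1 then f (k', u k') else 0.
have uS k : u k.+1 = f (k, u k) by [].
have un k n : rnorm (u k - u (k + n)%N) <= 3^-1 * (q ^+ k - q ^+ (k + n)).
  elim: n => [|n IH]; first by rewrite addn0 !subrr mulr0 rnorm0.
  apply: (le_trans (rnorm_tri (u (k + n)%N) _ _)).
  have [h _] := fP ((k + n)%N, u (k + n)%N); rewrite /= -uS rnormB in h.
  by rewrite addnS; move: IH h; rewrite exprS /q; lra.
have [e e0|k l kl|x xP] := @complete_rate _ V u (fun k => 3^-1 * q ^+ k).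
- have p3 : 0 <= 3^-1 :> R by rewrite invr_ge0.
  have [k ke] := pow2_small p3 e0.
  exists k; apply: le_lt_trans ke; rewrite ler_wpM2l ?invr_ge0//.
  by rewrite lerXn2r ?nnegrE ?invr_ge0// /q; lra.
- rewrite -(subnKC kl) (le_trans (un _ _))// ler_wpM2l ?invr_ge0//.
  by rewrite gerBl (ltW (qn _)).
have [M MP] := Tx x.
pose k := Num.bound `|M|.
have := MP (i k); apply/negP; rewrite -ltNge.
apply: (@lt_le_trans _ _ k%:R).
  by apply: (le_lt_trans (ler_norm _)); exact: archi_boundP.
have [_ h1] := fP (k, u k); rewrite /= -uS in h1.
have h2 := bop_rnorm (T (i k)) (u k.+1 - x); rewrite bopB in h2.
have h3 : rnorm (T (i k)) * rnorm (u k.+1 - x) <=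
    rnorm (T (i k)) * (3^-1 * q ^+ k.+1).
  by rewrite ler_wpM2l ?rnorm_ge0// rnormB.
have h4 : rnorm (T (i k) (u k.+1)) <=
    rnorm (T (i k) (u k.+1) - T (i k) x) + rnorm (T (i k) x).
  by rewrite (le_trans _ (rnormD _ _))// subrK.
have h5 : 3 * k%:R <= rnorm (T (i k)) * q ^+ k.+1.
  by rewrite -ler_pdivrMr// ltW.
by lra.
Qed.

End UniformBoundedness.

Section HilbertModuleFacts.
Context (R : realType) (A : wstarAlg R) (E : hmod A).
Implicit Types (x y z : E) (c : R[i]).

Lemma wstarD (a b : A) : wstar (a + b) = wstar a + wstar b.
Proof. by have := wstar_antilin 1 a b; rewrite rmorph1 !scale1r. Qed.

Lemma wstar0 : wstar (0 : A) = 0.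
Proof. by apply: (@addrI _ (wstar 0)); rewrite -wstarD !addr0. Qed.

Lemma wstarZ c (a : A) : wstar (c *: a) = conjc c *: wstar a.
Proof. by have := wstar_antilin c a 0; rewrite !addr0 wstar0 addr0. Qed.

Lemma innerDr x y z : inner x (y + z) = inner x y + inner x z.
Proof. exact: lin_add (inner_lin x) y z. Qed.

Lemma inner0r x : inner x 0 = 0.
Proof. exact: lin_zero (inner_lin x). Qed.

Lemma innerZr x c y : inner x (c *: y) = c *: inner x y.
Proof. exact: lin_scale (inner_lin x) c y. Qed.

Lemma innerBr x y z : inner x (y - z) = inner x y - inner x z.
Proof. exact: lin_sub (inner_lin x) y z. Qed.

Lemma innerDl x y z : inner (x + y) z = inner x z + inner y z.
Proof. by rewrite -inner_star innerDr wstarD !inner_star. Qed.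

Lemma innerZl c x y : inner (c *: x) y = conjc c *: inner x y.
Proof. by rewrite -inner_star innerZr wstarZ inner_star. Qed.

Lemma rnorm_inner x : rnorm (inner x x) = rnorm x ^+ 2.
Proof. by apply: complexI; rewrite -normE -inner_norm normE rmorphXn. Qed.

Lemma inner_eq0 x : inner x x = 0 -> x = 0.
Proof.
move=> xx; apply/rnorm0_eq0/eqP.
by rewrite -sqrf_eq0 -rnorm_inner xx rnorm0.
Qed.

Lemma inner_nondeg x y : (forall z, inner z x = inner z y) -> x = y.
Proof.
by move=> xy; apply/subr0_eq/inner_eq0; rewrite innerBr xy subrr.
Qed.

(** A crude substitute for Cauchy-Schwarz, enough for continuity. By polarization
    [2 <x, y> = D 1 - i D i], and [|D c| <= 2^2 + 1 + 1] for [|c| = 1]. *)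
Lemma inner_le1 x y : rnorm x <= 1 -> rnorm y <= 1 -> rnorm (inner x y) <= 6.
Proof.
move=> x1 y1.
pose D c := inner (x + c *: y) (x + c *: y) - inner x x - inner y y.
have DE c : conjc c * c = 1 -> D c = c *: inner x y + conjc c *: inner y x.
  move=> c1; rewrite /D innerDl !innerDr !innerZl !innerZr scalerA c1 scale1r.
  by rewrite addrAC addrA addrK addrC -(addrA (inner x x)) addKr.
have D6 c : complex.Re `|c| = 1 -> rnorm (D c) <= 6.
  move=> c1; have h0 := rnormD x (c *: y); rewrite rnormZ c1 mul1r in h0.
  have h1 := rnormD (inner (x + c *: y) (x + c *: y) - inner x x) (- inner y y).
  have h2 := rnormD (inner (x + c *: y) (x + c *: y)) (- inner x x).
  rewrite !rnormN !rnorm_inner in h1 h2; rewrite /D.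
  have h3 : rnorm (x + c *: y) ^+ 2 <= 2 ^+ 2.
    by rewrite ler_sqr ?nnegrE ?rnorm_ge0//; lra.
  have h4 : rnorm x ^+ 2 <= 1 by rewrite expr_le1 ?rnorm_ge0.
  have h5 : rnorm y ^+ 2 <= 1 by rewrite expr_le1 ?rnorm_ge0.
  by lra.
have i1 : complex.Re `|'i : R[i]| = 1.
  by rewrite normc_def /= expr0n expr1n add0r sqrtr1.
have e : 2 *: inner x y = D 1 + (- 'i) *: D 'i.
  rewrite !DE ?conjc1 ?mulr1//; last first.
    by apply/eqP; rewrite eq_complex; apply/andP; split; apply/eqP; simpc.
  rewrite !scale1r scalerDr !scalerA.
  have -> : - 'i * 'i = 1 :> R[i] 
    by apply/eqP; rewrite eq_complex; apply/andP; split; apply/eqP; simpc.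
  have -> : - 'i * conjc 'i = - 1 :> R[i].
    by apply/eqP; rewrite eq_complex; apply/andP; split; apply/eqP; simpc.
  by rewrite scale1r scaleN1r addrACA subrr addr0 scaler_nat mulr2n.
have := rnormD (D 1) (- 'i *: D 'i).
rewrite -e !rnormZ normrN i1 mul1r.
have -> : complex.Re `|2%:R : R[i]| = 2 by rewrite normr_nat raddfMn.
have := D6 1; rewrite normr1 => /(_ erefl).
by have := D6 _ i1; lra.
Qed.

Lemma inner_le x y : rnorm (inner x y) <= 6 * (rnorm x * rnorm y).
Proof.
have [->|x0] := eqVneq x 0.
  by rewrite -inner_star inner0r wstar0 !rnorm0 mul0r mulr0.
have [->|y0] := eqVneq y 0; first by rewrite inner0r !rnorm0 !mulr0.
have pos z : z != 0 -> 0 < rnorm z.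
  move=> z0; rewrite lt0r rnorm_ge0 andbT.
  by apply: contra_neq z0; exact: rnorm0_eq0.
have nC (c : R) : 0 <= c -> complex.Re `|c%:C| = c.
  by move=> c0; rewrite ger0_norm ?lecR.
have unit z : z != 0 -> rnorm ((rnorm z)^-1%:C *: z) <= 1.
  by move=> /pos z0; rewrite rnormZ nC ?invr_ge0 ?rnorm_ge0// mulVf ?gt_eqF.
have := inner_le1 (unit x x0) (unit y y0).
rewrite innerZl innerZr conjc_real !rnormZ !nC ?invr_ge0 ?rnorm_ge0//.
rewrite ler_pdivrMl ?pos// ler_pdivrMl ?pos//.
by rewrite mulrA mulrC (mulrC (rnorm y)).
Qed.

End HilbertModuleFacts.

Section LeftAction.
Context (R : realType) (A B : wstarAlg R) (E : corr A B).
Implicit Types (x y : E) (a : A).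

Lemma lact_adj' a x y : inner x (lact a y) = inner (lact (wstar a) x) y.
Proof. by rewrite lact_adj wstarK. Qed.

(** Linearity in the module variable comes from adjointability. *)
Lemma lact_linr a : linear (lact a : E -> E).
Proof.
by move=> c x y; apply: inner_nondeg => z; rewrite inner_lin !lact_adj' inner_lin.
Qed.

(** As in the Hellinger-Toeplitz theorem: the maps [<a g, _>] with [|g| <= 1] are bounded at each
    [x] through [a^* x], hence uniformly bounded; evaluating at [a g] bounds [|a g|]. *)
Lemma lact_bounded a :
  exists2 M : R, 0 <= M & forall x, rnorm (lact a x) <= M * rnorm x.
Proof.
pose I := {g : E | rnorm g <= 1}.
have lin (g : I) : linear (inner (lact a (sval g))) by exact: inner_lin.
have bd (g : I) (x : E) : rnorm (inner (lact a (sval g)) x) <=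
    6 * rnorm (lact a (sval g)) * rnorm x by rewrite -mulrA inner_le.
pose T g := mk_bop (lin g) (bd g).
have [x|M M0 MT] := @uniform_boundedness R E B I T.
  exists (6 * rnorm (lact (wstar a) x)) => -[g g1] /=.
  rewrite lact_adj (le_trans (inner_le _ _))// ler_wpM2l//.
  by rewrite ler_piMl// rnorm_ge0.
have M1 (g : E) : rnorm g <= 1 -> rnorm (lact a g) <= M.
  move=> g1; have [->//|g0] := eqVneq (rnorm (lact a g)) 0.
  have gp : 0 < rnorm (lact a g) by rewrite lt0r g0 rnorm_ge0.
  rewrite -(ler_pM2r gp) -expr2 -rnorm_inner.
  have := bop_rnorm (T (exist _ g g1)) (lact a g) => /le_trans; apply.
  by rewrite ler_wpM2r ?rnorm_ge0.
exists M => // x.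
have [x0|x0] := eqVneq (rnorm x) 0.
  by rewrite (rnorm0_eq0 x0) (lin_zero (lact_linr a)) !rnorm0 mulr0.
have xp : 0 < rnorm x by rewrite lt0r x0 rnorm_ge0.
have nC : complex.Re `|(rnorm x)^-1%:C| = (rnorm x)^-1.
  by rewrite ger0_norm ?lecR ?invr_ge0 ?rnorm_ge0.
have := M1 ((rnorm x)^-1%:C *: x); rewrite rnormZ nC mulVf// => /(_ (lexx _)).
by rewrite (lin_scale (lact_linr a)) rnormZ nC ler_pdivrMl// mulrC.
Qed.

End LeftAction.

(** * Normality and induced spaces *)

Section Normal.
Context (R : realType) (A : wstarAlg R).

Lemma pairing_bop_subproof (a : A) :
  (pairing (w := A))^~ a \in @bop_pred R (predual A) R[i]^o.
Proof. by apply/asboolP; split; [exact: pairing_linl|exact: pairing_cont]. Qed.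

Lemma pairing_le (p : predual A) (a : A) :
  rnorm (pairing p a) <= rnorm p * rnorm a.
Proof.
rewrite -lecR rmorphM /= -!normE (pairing_norm a) mulrC.
exact: (le_opnorm (Bop (pairing_bop_subproof a)) p).
Qed.

Lemma pairing_sep (a : A) : (forall p : predual A, pairing p a = 0) -> a = 0.
Proof.
move=> pa; apply/normr0_eq0; rewrite pairing_norm.
have -> : (pairing (w := A))^~ a = bop_fun (0 : bop (predual A) R[i]^o).
  by apply/funext => p; rewrite pa.
exact: (@normr0 _ (bop (predual A) R[i]^o)).
Qed.

Lemma normal_fun_bounded (f : A -> R[i]) : normal_fun f ->
  exists2 M : R, 0 <= M & forall a, rnorm (f a : R[i]^o) <= M * rnorm a.
Proof.
by move=> [p ->]; exists (rnorm p); [exact: rnorm_ge0|exact: pairing_le].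
Qed.

Lemma normal_fun_eq0 (S : set A) (f : A -> R[i]) : wdense (lspan S) ->
  normal_fun f -> (forall a, S a -> f a = 0) -> forall a, f a = 0.
Proof.
move=> Sd [p ->] Sp a; apply: (@rnorm_small _ R[i]^o) => e e0.
have [|b [n [c [s [sS ->]]]] /(_ p)] := Sd a [:: p] e%:C; first by rewrite ltcR.
rewrite mem_head => /(_ isT).
rewrite (lin_sum (pairing_linr p)) big1 => [|i _]; last first.
  by rewrite (lin_scale (pairing_linr p)) Sp ?scaler0.
by rewrite sub0r normrN normE ltcR => /ltW.
Qed.

Lemma hm_normal_fun_eq0 (E : hmod A) (S : set E) (f : E -> R[i]^o) :
  hm_wdense (lspan S) -> linear f -> hm_normal_fun f ->
  (forall x, S x -> f x = 0) -> forall x, f x = 0.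
Proof.
move=> Sd lf nf Sf x; apply: rnorm_small => e e0.
have [//||y [n [c [s [sS ->]]]] /(_ ord0)] := Sd x 1%N (fun=> f) e%:C.
  by rewrite ltcR.
rewrite (lin_sum lf) big1 => [|i _]; last by rewrite (lin_scale lf) Sf ?scaler0.
by rewrite sub0r normrN => fx; apply: ltW; rewrite -ltcR -normE.
Qed.

(** Each [x |-> p (<d, x>)] is a normal functional vanishing on [S], hence everywhere, in particular
    at [d]; the predual separates points. *)
Lemma hm_wdense_orth (E : hmod A) (S : set E) (d : E) :
  hm_wdense (lspan S) -> (forall x, S x -> inner x d = 0) -> d = 0.
Proof.
move=> Sd dS; apply/inner_eq0/pairing_sep => p.
apply: (hm_normal_fun_eq0 (f := fun x => pairing p (inner d x)) Sd).
- by move=> c x y; rewrite inner_lin pairing_linr.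
- move=> e e0; exists [:: (d, p)] => x; rewrite big_seq1 subrr normr0.
  by rewrite mulr_ge0// ltW.
- move=> x Sx; rewrite -inner_star dS// wstar0.
  exact: lin_zero (pairing_linr p).
Qed.

End Normal.

(** The factor [1 + M] stands in for the square root of [M], since only boundedness is at stake. *)
Lemma sqr_le_bound (R : realType) (M x y : R) : 0 <= M -> 0 <= x -> 0 <= y ->
  x ^+ 2 <= M * y ^+ 2 -> x <= (1 + M) * y.
Proof.
move=> M0 x0 y0 xy; rewrite -ler_sqr ?nnegrE ?mulr_ge0 ?addr_ge0//.
rewrite (le_trans xy)// exprMn ler_wpM2r ?sqr_ge0//.
by have := sqr_ge0 M; rewrite sqrrD; lra.
Qed.

Section InducedSpace.
Context (R : realType) (A B : wstarAlg R) (E : corr A B) (H : hilb R).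
Context (s : nrep B H) (T : htensor E s).

Lemma ht_le_r (x : E) (h : H) :
  rnorm (ht T x h) <= (1 + rnorm (s (inner x x))) * rnorm h.
Proof.
apply: sqr_le_bound; rewrite ?rnorm_ge0//.
rewrite rnorm_sqr_hip ht_inner (le_trans (hip_CS _ _))//.
by rewrite mulrC expr2 mulrA ler_wpM2r ?rnorm_ge0// bop_rnorm.
Qed.

(** Normality gives the bound: [b |-> <h, s b h>] comes from the predual, hence is bounded, and it
    is applied to [<x, x>]. *)
Lemma ht_le_l (h : H) :
  exists2 M : R, 0 <= M & forall x : E, rnorm (ht T x h) <= M * rnorm x.
Proof.
have [M M0 Mb] := normal_fun_bounded (rep_normal s h h).
exists (1 + M); first by rewrite addr_ge0.
move=> x; apply: sqr_le_bound; rewrite ?rnorm_ge0//.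
by rewrite rnorm_sqr_hip ht_inner -rnorm_inner.
Qed.

Definition htop (x : E) : bop H T := mk_bop (@ht_linr _ _ _ _ _ _ T x) (ht_le_r x).

Lemma htopE x h : htop x h = ht T x h. Proof. by []. Qed.

Lemma ht_total : total_family (fun p : E * H => ht T p.1 p.2).
Proof.
move=> u uT; apply: rnorm_small => e e0.
have : closure (lspan [set z | exists x h, z = ht T x h]) u by rewrite ht_dense.
move=> /(_ (ball u e%:C)); case.
  by apply: nbhsx_ballx; rewrite ltcR.
move=> z [[n [c [v [vT ->]]]]]; rewrite -ball_normE /ball_ /= normE ltcR.
set w := \sum_(_ < _) _ => we.
have wu : hip w u = 0.
  rewrite hip_suml big1// => i _; rewrite hipZl.
  by have [x [h ->]] := vT i; rewrite (uT (x, h)) mulr0.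
have [->|u0] := eqVneq (rnorm u) 0; first exact: ltW.
have up : 0 < rnorm u by rewrite lt0r u0 rnorm_ge0.
rewrite -(ler_pM2r up) -expr2 rnorm_sqr_hip -[hip u u]subr0 -[0 in leLHS]wu.
rewrite -hipBl (le_trans (hip_CS _ _))// ler_wpM2r ?rnorm_ge0//.
exact: ltW.
Qed.

Lemma adj_htop x y h : adj (htop x) (ht T y h) = s (inner x y) h.
Proof. by apply: hip_nondeg => k; rewrite adjE' ht_inner. Qed.

(** Unitality of the left action passes to [indrep]. It allows a vector to be recovered by
    evaluating normal functionals at the unit. *)
Lemma indrep1 u : indrep T (wone A) u = u.
Proof.
have lid : linear (@id T) by [].
have bid (z : T) : rnorm (id z) <= 1 * rnorm z by rewrite mul1r.
apply: (total_bop_eq (T := mk_bop lid bid) ht_total) => -[x h] /=.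
by rewrite indrepE lact1.
Qed.

End InducedSpace.

Arguments ht_total {R A B E H s} T.

Section Contraction.
Context (R : realType) (A B D : wstarAlg R) (X : corr A B) (F : corr B D).
Context (XF : wtensor X F).
Implicit Types (x y : X) (f g : F) (w : XF).

Lemma wt_bounded y :
  exists2 M : R, 0 <= M & forall f, rnorm (wt XF y f) <= M * rnorm f.
Proof.
have [M M0 MP] := lact_bounded F (inner y y).
have M6 : 0 <= 6 * M by rewrite mulr_ge0.
exists (1 + 6 * M); first by rewrite addr_ge0.
move=> f; apply: sqr_le_bound; rewrite ?rnorm_ge0//.
rewrite -rnorm_inner wt_inner (le_trans (inner_le _ _))// -mulrA ler_wpM2l//.
by rewrite mulrC expr2 mulrA ler_wpM2r ?rnorm_ge0.
Qed.

Lemma contr_ex y w : exists g, forall f, inner f g = inner (wt XF y f) w.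
Proof.
have [M M0 MP] := wt_bounded y.
pose phi f := inner w (wt XF y f).
have lphi : linear phi by move=> c f g; rewrite /phi wt_linr inner_lin.
have bphi f : rnorm (phi f) <= 6 * rnorm w * M * rnorm f.
  by rewrite (le_trans (inner_le _ _))// -!mulrA ler_wpM2l// ler_wpM2l ?rnorm_ge0.
have [|g gP] := @corr_selfdual _ _ _ F phi lphi
  (@bop_continuous _ _ _ (mk_bop lphi bphi)).
  by move=> f a; rewrite /phi -wt_ract innerM.
by exists g => f; rewrite -inner_star -[inner g f]/((inner g) f) -gP inner_star.
Qed.

(* [contr y] is the adjoint of the creation operator [f |-> y (x) f]; it exists
   because [F] is selfdual. *)
Definition contr y w : F := sval (cid (contr_ex y w)).

Lemma contrE f y w : inner f (contr y w) = inner (wt XF y f) w.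
Proof. by rewrite /contr; case: cid. Qed.

Lemma contr_linear y : linear (contr y).
Proof.
by move=> c w w'; apply: inner_nondeg => f; rewrite inner_lin !contrE inner_lin.
Qed.

Lemma contr_bounded y :
  exists2 M : R, 0 <= M & forall w, rnorm (contr y w) <= M * rnorm w.
Proof.
have [M M0 MP] := wt_bounded y; exists (6 * M); first by rewrite mulr_ge0.
move=> w; have [->|g0] := eqVneq (rnorm (contr y w)) 0.
  by rewrite !mulr_ge0 ?rnorm_ge0.
have gp : 0 < rnorm (contr y w) by rewrite lt0r g0 rnorm_ge0.
rewrite -(ler_pM2r gp) -expr2 -rnorm_inner contrE (le_trans (inner_le _ _))//.
rewrite -!mulrA ler_wpM2l// (mulrC (rnorm w)) mulrA.
by rewrite ler_wpM2r ?rnorm_ge0.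
Qed.

Lemma contr_wt y x f : contr y (wt XF x f) = lact (inner y x) f.
Proof. by apply: inner_nondeg => g; rewrite contrE wt_inner. Qed.

Lemma contr_lact y a w : contr y (lact a w) = contr (lact (wstar a) y) w.
Proof.
by apply: inner_nondeg => f; rewrite !contrE lact_adj' wt_lact.
Qed.

Lemma contr_ract y b w : contr (ract y b) w = lact (wstar b) (contr y w).
Proof.
by apply: inner_nondeg => f; rewrite contrE wt_bal -lact_adj contrE.
Qed.

End Contraction.

Section EquivalenceContraction.
Context (R : realType) (A B D : wstarAlg R) (X : equivBimod A B) (F : corr B D).
Context (XF : wtensor X F).
Implicit Types (x y : X) (w : XF).

(** Compatibility identifies the rank-one operator of [x] and [y] with the left action of
    [linner x y]. It suffices to pair both sides with simple tensors. *)
Lemma wt_contr x y w : wt XF x (contr y w) = lact (linner x y) w.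
Proof.
apply/subr0_eq/(hm_wdense_orth (wt_dense (w := XF))) => _ [z [f ->]].
apply/eqP; rewrite innerBr subr_eq0; apply/eqP.
rewrite wt_inner lact_adj' inner_star contrE -wt_bal.
by rewrite lact_adj' linner_star wt_lact linner_compat.
Qed.

Lemma inner_contr x y w w' :
  inner (contr x w) (contr y w') = inner w (lact (linner x y) w').
Proof. by rewrite contrE wt_contr lact_adj linner_star. Qed.

End EquivalenceContraction.

(** * Covectors of equivalent correspondences *)

Section BopComposition.
Context (R : realType) (U V W : normedModType R[i]).

Lemma bop_comp_linear (S : bop V W) (T : bop U V) : linear (S \o T).
Proof. by move=> c x y /=; rewrite !bop_linear. Qed.

Lemma bop_comp_le (S : bop V W) (T : bop U V) x :
  rnorm ((S \o T) x) <= rnorm S * rnorm T * rnorm x.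
Proof.
rewrite (le_trans (bop_rnorm _ _))// -mulrA ler_wpM2l ?rnorm_ge0//.
exact: bop_rnorm.
Qed.

Definition bop_comp S T : bop U W := mk_bop (bop_comp_linear S T) (bop_comp_le S T).

End BopComposition.

Lemma bop_lincomb (R : realType) (U V : normedModType R[i]) (T : bop U V)
    (J : Type) (g : J -> U) t : T (lincomb g t) = lincomb (fun j => T (g j)) t.
Proof.
rewrite /lincomb (lin_sum (bop_linear T)); apply: eq_bigr => p _.
exact: bopZ.
Qed.

Lemma adjK (R : realType) (H K : hilb R) (T : bop H K) : adj (adj T) =1 T.
Proof. by move=> x; apply: hip_nondeg => k; rewrite adjE' adjE. Qed.

Section InducedCovectors.
Context (R : realType) (A B : wstarAlg R) (E : corr A A) (F : corr B B).
Context (X : equivBimod A B) (EX : wtensor E X) (XF : wtensor X F).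
Context (W : EX -> XF) (isoW : corr_iso W).
Context (H : hilb R) (s : nrep B H).
Context (FH : htensor F s) (XH : htensor X s) (EXH : htensor E (indrep XH)).

Let gen (p : E * (X * H)) : EXH := ht EXH p.1 (ht XH p.2.1 p.2.2).

Let gen_total : total_family gen.
Proof.
move=> u gu; apply: (ht_total EXH) => -[e z] /=.
rewrite -htopE -adjE' (_ : adj _ u = 0) ?hip0r//.
by apply: (ht_total XH) => -[x h] /=; rewrite adjE'; exact: (gu (e, (x, h))).
Qed.

Let W_inner z z' : inner (W z) (W z') = inner z z'.
Proof. by case: isoW. Qed.

Let W_lact a z : W (lact a z) = lact a (W z).
Proof. by case: isoW. Qed.

Let W_linear : linear W.
Proof. by case: isoW. Qed.

Let rnorm_W z : rnorm (W z) = rnorm z.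
Proof.
apply/eqP; rewrite -(eqrXn2 (_ : (0 < 2)%N)) ?rnorm_ge0//.
by rewrite -!rnorm_inner W_inner.
Qed.

(** The value intended for [cop y] at [gen p]: [W] carries [e (x) x] into [XF], and [y] is then
    contracted away. *)
Let cgen y (p : E * (X * H)) : FH :=
  ht FH (contr y (W (wt EX p.1 p.2.1))) p.2.2.

(** By [inner_contr] the two contractions amount to the left action of [linner y y'], which commutes
    with [W]. This gives both the boundedness of [cop y] and the formula for [C_y^* C_y']. *)
Let cgen_hip y y' p q :
  hip (cgen y p) (cgen y' q) = hip (gen p) (indrep EXH (linner y y') (gen q)).
Proof.
rewrite /cgen /gen indrepE !ht_inner indrepE ht_inner inner_contr.
by rewrite -W_lact W_inner wt_lact wt_inner.
Qed.

Let cop_ex y : exists T : bop EXH FH, forall p, T (gen p) = cgen y p.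
Proof.
set a := indrep EXH (linner y y).
have a0 : 0 <= 1 + rnorm a by rewrite addr_ge0 ?rnorm_ge0.
have [|T [Tg _]] := bop_extension a0 gen_total (g' := cgen y); last by exists T.
move=> t; apply: sqr_le_bound; rewrite ?rnorm_ge0//.
have E1 : hip (lincomb (cgen y) t) (lincomb (cgen y) t) =
    hip (lincomb gen t) (a (lincomb gen t)).
  by rewrite bop_lincomb; apply: hip_lincomb_eq => p q; exact: cgen_hip.
rewrite rnorm_sqr_hip E1 (le_trans (hip_CS _ _))//.
by rewrite mulrC expr2 mulrA ler_wpM2r ?rnorm_ge0// bop_rnorm.
Qed.

(* In terms of the unitary [u : EXH -> X (x) (F (x) H)] induced by [W], the
   operator [cop y] is [u] followed by the adjoint of [z |-> y (x) z]; the
   space [X (x) (F (x) H)] itself is not needed. *)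
Let cop y : bop EXH FH := sval (cid (cop_ex y)).

Let cop_gen y p : cop y (gen p) = cgen y p.
Proof. by rewrite /cop; case: cid. Qed.

Let adj_cop_cop y y' u : adj (cop y) (cop y' u) = indrep EXH (linner y y') u.
Proof.
apply: (total_bop_eq (S := bop_comp (adj (cop y)) (cop y')) gen_total) => q /=.
apply/subr0_eq/gen_total => p.
by rewrite hipBr adjE' !cop_gen cgen_hip subrr.
Qed.

Let htop_adj_htop y y' z :
  htop XH y (adj (htop XH y') z) = indrep XH (linner y y') z.
Proof.
apply: (total_bop_eq (S := bop_comp (htop XH y) (adj (htop XH y')))
  (T := indrep XH (linner y y')) (ht_total XH)).
by move=> -[x h] /=; rewrite adj_htop indrepE linner_compat ht_bal.
Qed.

Let cop_indrep y a u : cop y (indrep EXH a u) = cop (lact (wstar a) y) u.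
Proof.
apply: (total_bop_eq (S := bop_comp (cop y) (indrep EXH a)) gen_total).
move=> [e [x h]] /=; rewrite cop_gen {1}/gen indrepE /=.
rewrite -[ht _ _ _]/(gen (lact a e, (x, h))) cop_gen /cgen /=.
by rewrite -wt_lact W_lact contr_lact.
Qed.

Let cop_ract y b u : cop (ract y b) u = indrep FH (wstar b) (cop y u).
Proof.
apply: (total_bop_eq (T := bop_comp (indrep FH (wstar b)) (cop y)) gen_total).
by move=> p /=; rewrite !cop_gen /cgen indrepE contr_ract.
Qed.

(** A vector [u] orthogonal to all these ranges is killed by every [cop y], so the normal functional
    [a |-> <u, a u>] vanishes on the left inner products, hence at the unit. *)
Let adj_cop_total : total_family (fun p : X * FH => adj (cop p.1) p.2).
Proof.
move=> u uC.
have Cu y : cop y u = 0.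
  by apply/hip_nondeg => z; rewrite hip0r -adjE (uC (y, z)).
have := normal_fun_eq0 (linner_full X) (rep_normal (indrep EXH) u u).
move=> /(_ _ (wone A)); rewrite indrep1 => uu.
suff : hip u u = 0.
  by rewrite hipxx => /complexI/eqP; rewrite sqrf_eq0 => /eqP/rnorm0_eq0.
by apply: uu => _ [x [y ->]]; rewrite -adj_cop_cop adjE' Cu hip0l.
Qed.

(** If [xi] is a combination of simple tensors [f (x) h'], the functional is a sum of terms
    [q (<V (y (x) f), z>)] with [V] inverse to [W] and [q] in the predual. The general [xi] is a
    norm limit of these. *)
Let hip_contr_normal (xi : FH) y h :
  hm_normal_fun (fun z : EX => hip xi (ht FH (contr y (W z)) h)).
Proof.
move=> e e0; have eE : e = (complex.Re e)%:C.
  by apply/esym/eqP; rewrite RRe_real// gtr0_real.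
have r0 : 0 < complex.Re e by rewrite -ltcR -eE.
have [M M0 MP] := contr_bounded XF y.
have [K K0 KP] := ht_le_l FH h.
have KM : 0 < K * M + 1 by rewrite ltr_wpDl// mulr_ge0.
(* [K * M] bounds [z |-> contr y (W z) (x) h]; adding 1 keeps the divisor positive. *)
have [|t xit] := total_dense (ht_total FH) xi (e := complex.Re e / (K * M + 1)).
  by rewrite divr_gt0.
have [_ [V VW WV] _ _ _] := isoW.
have /choice[q qP] (p : R[i] * (F * H)) : exists q : predual B,
  (fun b => hip (p.1 *: p.2.2) (s b h)) = pairing q by exact: rep_normal.
exists [seq (V (wt XF y p.2.1), q p) | p <- t] => z.
have -> : \sum_(w <- [seq (V (wt XF y p.2.1), q p) | p <- t])
    pairing w.2 (inner w.1 z) =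
    hip (lincomb (fun p : F * H => ht FH p.1 p.2) t) (ht FH (contr y (W z)) h).
  rewrite big_map hip_suml; apply: eq_bigr => p _.
  rewrite -qP /= hipZl hipZl ht_inner; congr (_ * hip _ (s _ h)).
  by rewrite contrE -W_inner WV.
rewrite -hipBl eE !normE -rmorphM lecR (le_trans (hip_CS _ _))//.
have h1 : rnorm (ht FH (contr y (W z)) h) <= (K * M + 1) * rnorm z.
  rewrite (le_trans (KP _))// -(rnorm_W z) mulrDl mul1r -mulrA.
  by rewrite (le_trans (ler_wpM2l K0 (MP _)))// lerDl rnorm_ge0.
apply: (le_trans (ler_pM (rnorm_ge0 _) (rnorm_ge0 _) xit h1)).
by rewrite mulrA divfK// gt_eqF.
Qed.

(** Orthogonality to the ranges is known only on [e (x) x]; normality spreads it to all of [EX]. As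
    [W] is onto, [z] may be taken with [W z = y (x) f], so that contracting by [x] gives [<x, y> f];
    fullness of the right inner product then reaches the unit. *)
Let cop_total : total_family (fun p : X * EXH => cop p.1 p.2).
Proof.
move=> xi xiC.
have contr0 y h z : hip xi (ht FH (contr y (W z)) h) = 0.
  apply: (hm_normal_fun_eq0 (wt_dense (w := EX)) _ (hip_contr_normal xi y h)).
    by move=> c z1 z2; rewrite W_linear contr_linear ht_linl hip_lin.
  move=> _ [e [x ->]]; apply: hip_eq0.
  by rewrite -[ht _ _ _]/(cgen y (e, (x, h))) -cop_gen (xiC (y, _)).
have [_ [V VW WV] _ _ _] := isoW.
apply: (ht_total FH) => -[f h] /=; apply: hip_eq0.
have := normal_fun_eq0 (inner_full X) (rep_normal (indrep FH) xi (ht FH f h)).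
move=> /(_ _ (wone B)); rewrite indrep1; apply.
move=> _ [x [y ->]]; rewrite indrepE -(contr_wt XF) -[wt XF _ _]WV.
exact: contr0.
Qed.

(** Deduced from [adj_cop_cop] on the ranges of the [C_y'']: compatibility turns [linner y'' y']
    acting on [y] into [y'' <y', y>], and [cop_ract] takes the right factor out. *)
Let cop_adj_cop y y' xi : cop y (adj (cop y') xi) = indrep FH (inner y y') xi.
Proof.
apply: (total_bop_eq (S := bop_comp (cop y) (adj (cop y'))) cop_total).
move=> [y'' u] /=; rewrite adj_cop_cop cop_indrep linner_star linner_compat.
by rewrite cop_ract inner_star.
Qed.

(* [ampl eta zeta]: up to the unitary [EXH -> X (x) (F (x) H)], [zeta] is
   [I (x) eta]. *)
Let ampl (eta : FH -> H) (zeta : EXH -> XH) : Prop :=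
  forall y xi, zeta (adj (cop y) xi) = ht XH y (eta xi).

Let coampl (eta : FH -> H) (zeta : EXH -> XH) : Prop :=
  forall y u, eta (cop y u) = adj (htop XH y) (zeta u).

(** On vectors [adj (cop y') xi] both sides become [s (inner y y') (eta xi)], by the intertwining
    property of [eta]. *)
Let ampl_coampl (eta : covec FH) (zeta : bop EXH XH) :
  ampl (covec_bop eta) zeta -> coampl (covec_bop eta) zeta.
Proof.
have etaP b z : covec_bop eta (indrep FH b z) = s b (covec_bop eta z).
  by case: eta => /= t /asboolP.
move=> a y u.
apply: (total_bop_eq (S := bop_comp (covec_bop eta) (cop y))
  (T := bop_comp (adj (htop XH y)) zeta) adj_cop_total) => -[y' xi] /=.
by rewrite cop_adj_cop etaP a adj_htop.
Qed.

Let coampl_ampl (eta : bop FH H) (zeta : covec EXH) :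
  coampl eta (covec_bop zeta) -> ampl eta (covec_bop zeta).
Proof.
have zetaP b z : covec_bop zeta (indrep EXH b z) = indrep XH b (covec_bop zeta z).
  by case: zeta => /= t /asboolP.
move=> a y xi.
apply: (total_bop_eq (S := bop_comp (covec_bop zeta) (adj (cop y)))
  (T := bop_comp (htop XH y) eta) cop_total) => -[y' u] /=.
by rewrite adj_cop_cop zetaP a -[RHS]htopE htop_adj_htop.
Qed.

Let ampl_ex (eta : covec FH) : exists zeta : covec EXH,
  ampl (covec_bop eta) (covec_bop zeta) /\ `|zeta| <= `|eta|.
Proof.
have etaP b z : covec_bop eta (indrep FH b z) = s b (covec_bop eta z).
  by case: eta => /= t /asboolP.
(* The hypothesis of [bop_transfer] for [P_y = C_y^*] and [Q_y = htop XH y], whence the double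
   adjoint. *)
have comm y y' xi : covec_bop eta (adj (adj (cop y)) (adj (cop y') xi)) =
    adj (htop XH y) (htop XH y' (covec_bop eta xi)).
  by rewrite adjK cop_adj_cop etaP adj_htop.
have [Z [ZP Zle]] := bop_transfer comm adj_cop_total.
have Zcov : Z \in @covec_pred _ _ _ _ _ EXH.
  apply/asboolP => a u.
  apply: (total_bop_eq (S := bop_comp Z (indrep EXH a))
    (T := bop_comp (indrep XH a) Z) adj_cop_total) => -[y xi] /=.
  (* The adjoint form of [cop_indrep]. *)
  have -> : indrep EXH a (adj (cop y) xi) = adj (cop (lact a y)) xi.
    apply: hip_nondeg => v; rewrite adjE' -{2}(wstarK a) -cop_indrep -adjE'.
    by rewrite rep_adj wstarK.
  by rewrite !ZP /= indrepE.
exists (Covec Zcov); split; first exact: ZP.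
by rewrite -[`|Covec _|]/(`|Z|) -[`|eta|]/(`|covec_bop eta|) !normE lecR.
Qed.

Let coampl_ex (zeta : covec EXH) : exists eta : covec FH,
  coampl (covec_bop eta) (covec_bop zeta) /\ `|eta| <= `|zeta|.
Proof.
have zetaP b z : covec_bop zeta (indrep EXH b z) = indrep XH b (covec_bop zeta z).
  by case: zeta => /= t /asboolP.
have comm y y' u : covec_bop zeta (adj (cop y) (cop y' u)) =
    adj (adj (htop XH y)) (adj (htop XH y') (covec_bop zeta u)).
  by rewrite adjK adj_cop_cop zetaP htop_adj_htop.
have [N [NP Nle]] := bop_transfer comm cop_total.
have Ncov : N \in @covec_pred _ _ _ _ _ FH.
  apply/asboolP => b xi.
  apply: (total_bop_eq (S := bop_comp N (indrep FH b))
    (T := bop_comp (s b) N) cop_total) => -[y u] /=.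
  rewrite -{1}(wstarK b) -cop_ract !NP.
  apply: hip_nondeg => k; rewrite adjE' /= ht_bal -[ht _ _ _]htopE -adjE'.
  by rewrite rep_adj wstarK.
exists (Covec Ncov); split; first exact: NP.
by rewrite -[`|Covec _|]/(`|N|) -[`|zeta|]/(`|covec_bop zeta|) !normE lecR.
Qed.

Let covec_eq C (G : corr C C) (K : hilb R) (r : nrep C K) (T : htensor G r)
  (eta eta' : covec T) : covec_bop eta =1 covec_bop eta' -> eta = eta'.
Proof. by move=> e; apply/val_inj/bop_eq. Qed.

(** Each of the two relations determines its solution, since the ranges are total; this yields
    linearity. As each relation implies the other, the two contractions are mutually inverse, hence
    isometric. *)
Lemma covec_isometry : exists (phi : covec FH -> covec EXH)
    (psi : covec EXH -> covec FH),
  [/\ linear phi, linear psi, cancel phi psi, cancel psi phi &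
    (forall eta, `|phi eta| <= `|eta|) /\ (forall zeta, `|psi zeta| <= `|zeta|)].
Proof.
have /choice[phi phiP] := ampl_ex; have /choice[psi psiP] := coampl_ex.
have phi_uniq eta zeta : ampl (covec_bop eta) (covec_bop zeta) -> zeta = phi eta.
  move=> a; apply/covec_eq; apply: (total_bop_eq adj_cop_total) => -[y xi] /=.
  by rewrite a (proj1 (phiP eta)).
have psi_uniq eta zeta : coampl (covec_bop eta) (covec_bop zeta) -> eta = psi zeta.
  move=> a; apply/covec_eq; apply: (total_bop_eq cop_total) => -[y u] /=.
  by rewrite a (proj1 (psiP zeta)).
have covecE (K : hilb R) C (G : corr C C) (r : nrep C K) (T : htensor G r) c
    (eta eta' : covec T) x : covec_bop (c *: eta + eta') x =
    c *: covec_bop eta x + covec_bop eta' x by [].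
exists phi, psi; split.
- move=> c eta eta'; apply/esym/phi_uniq => y xi.
  by rewrite !covecE !(proj1 (phiP _)) ht_linr.
- move=> c zeta zeta'; apply/esym/psi_uniq => y u.
  by rewrite !covecE !(proj1 (psiP _)) bop_linear.
- by move=> eta; apply/esym/psi_uniq/ampl_coampl; case: (phiP eta).
- by move=> zeta; apply/esym/phi_uniq/coampl_ampl; case: (psiP zeta).
- by split => [eta|zeta]; [case: (phiP eta)|case: (psiP zeta)].
Qed.

End InducedCovectors.

(** * Ball categories *)

Section BallTransport.
Context (R : realType) (V V' : normedModType R[i]).
Context (phi : V -> V') (phi_le : forall x, `|phi x| <= `|x|).

Definition ball_map (x : uball V) : uball V' :=
  exist _ (phi (sval x)) (le_lt_trans (phi_le (sval x)) (svalP x)).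

End BallTransport.

Lemma uball_eq (R : realType) (V : normedModType R[i]) (x y : uball V) :
  sval x = sval y -> x = y.
Proof. by move=> xy; apply: eq_sig_hprop => // ? ? ?; exact: Prop_irrelevance. Qed.

Lemma linear_contraction_differentiable (R : realType) (V V' : normedModType R[i])
    (phi : V -> V') : linear phi -> (forall x, `|phi x| <= `|x|) ->
  forall x, differentiable phi x.
Proof.
move=> lphi phi_le x.
pose F : {linear V -> V'} := HB.pack phi (GRing.isLinear.Build _ _ _ _ phi lphi).
apply: (@linear_differentiable _ _ _ F); apply: bounded_linear_continuous.
by apply/linear_boundedP; near=> r => y /=; rewrite (le_trans (phi_le y))//
  ler_peMl//; near: r; exact: nbhs_pinfty_ge.
Unshelve. all: by end_near. Qed.

Section BallFunctor.
Context (R : realType) (V V' : normedModType R[i]).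
Context (phi : V -> V') (psi : V' -> V).
Context (phi_lin : linear phi) (phi_le : forall x, `|phi x| <= `|x|).
Context (psi_lin : linear psi) (psi_le : forall y, `|psi y| <= `|y|).
Context (phiK : cancel phi psi) (psiK : cancel psi phi).

Let bphi := ball_map phi_le.
Let bpsi := ball_map psi_le.

Lemma ball_mapK : cancel bphi bpsi.
Proof. by move=> x; apply: uball_eq; exact: phiK. Qed.

Lemma holo_conj g : holo g -> holo (bphi \o g \o bpsi).
Proof.
move=> [G gG dG]; exists (phi \o G \o psi) => y; first by rewrite /= gG.
apply: differentiable_comp.
  exact: linear_contraction_differentiable.
apply: differentiable_comp; first exact: (dG (bpsi y)).
exact: linear_contraction_differentiable.
Qed.

Lemma biholo_conj g : biholo g -> biholo (bphi \o g \o bpsi).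
Proof.
move=> [hg [h [gh hg' hh]]]; split; first exact: holo_conj.
have psiK' : cancel bpsi bphi by move=> y; apply: uball_eq; exact: psiK.
exists (bphi \o h \o bpsi); split; last exact: holo_conj.
  by move=> y /=; rewrite ball_mapK gh psiK'.
by move=> y /=; rewrite ball_mapK hg' psiK'.
Qed.

Definition ball_mor (x y : uball V) (g : ball_hom x y) :
  ball_hom (bphi x) (bphi y).
Proof.
exists (exist _ _ (biholo_conj (svalP (sval g)))).
by rewrite /= ball_mapK (svalP g).
Defined.

Lemma ball_mor1 x : ball_mor (ball_hom_id x) = ball_hom_id (bphi x).
Proof.
by apply: ball_hom_eq; apply/funext => y; apply: uball_eq; exact: psiK.
Qed.

Lemma ball_morM x y z (g : ball_hom y z) (f : ball_hom x y) :
  ball_mor (ball_hom_comp g f) = ball_hom_comp (ball_mor g) (ball_mor f).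
Proof. by apply: ball_hom_eq; apply/funext => w /=; rewrite ball_mapK. Qed.

Definition ball_functor : functor (ball_cat V) (ball_cat V') :=
  @Functor (ball_cat V) (ball_cat V') bphi ball_mor ball_mor1 ball_morM.

End BallFunctor.

Section BallEquivalence.
Context (R : realType).

(** The composite fixes objects only up to a propositional equality. The natural isomorphism is
    therefore the identity automorphism, with that equality as proof that it carries one object to
    the other. *)
Lemma ball_functor_inverse (V V' : normedModType R[i])
    (phi : V -> V') (psi : V' -> V)
    (phi_lin : linear phi) (phi_le : forall x, `|phi x| <= `|x|)
    (psi_lin : linear psi) (psi_le : forall y, `|psi y| <= `|y|)
    (phiK : cancel phi psi) (psiK : cancel psi phi) :
  nat_iso
    (functor_comp (ball_functor psi_lin psi_le phi_lin phi_le psiK phiK)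
                  (ball_functor phi_lin phi_le psi_lin psi_le phiK psiK))
    (functor_id (ball_cat V)).
Proof.
have K : cancel (ball_map phi_le) (ball_map psi_le) by exact: ball_mapK.
pose t (a : uball V) : ball_hom (ball_map psi_le (ball_map phi_le a)) a :=
  exist _ (aut_id V) (K a).
pose u (a : uball V) : ball_hom a (ball_map psi_le (ball_map phi_le a)) :=
  exist _ (aut_id V) (esym (K a)).
exists t, u; split => [a b f|a|a]; apply: ball_hom_eq => //.
by apply/funext => x /=; rewrite !K.
Qed.

Lemma isometric_ball_cat (V V' : normedModType R[i])
    (phi : V -> V') (psi : V' -> V) :
  linear phi -> (forall x, `|phi x| <= `|x|) ->
  linear psi -> (forall y, `|psi y| <= `|y|) ->
  cancel phi psi -> cancel psi phi ->
  equivalent_cat (ball_cat V) (ball_cat V').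
Proof.
move=> phi_lin phi_le psi_lin psi_le phiK psiK.
exists (ball_functor phi_lin phi_le psi_lin psi_le phiK psiK).
exists (ball_functor psi_lin psi_le phi_lin phi_le psiK phiK).
by split; exact: ball_functor_inverse.
Qed.

End BallEquivalence.

Theorem theorem4p1 (R : realType) (A B : wstarAlg R)
    (E : corr A A) (F : corr B B) (X : equivBimod A B)
    (EF : morita_via E F X)
    (H : hilb R) (s : nrep B H)
    (FH : htensor F s) (XH : htensor X s) (EXH : htensor E (indrep XH)) :
  equivalent_cat (covrep FH) (covrep EXH).
Proof.
have [EX [XF [W isoW]]] := EF.
have [phi [psi [phi_lin psi_lin phiK psiK [phi_le psi_le]]]] :=
  covec_isometry isoW FH EXH.
exact: isometric_ball_cat phi_lin phi_le psi_lin psi_le phiK psiK.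
Qed.
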